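(* Let $P$ be a CPPOS, $p\in\operatorname{int}(P)$, fix a non-empty cell of the pencil through $p$ supported on the sides $e_i$ and $e_j$, and suppose that the supporting lines $L_i$ and $L_j$ are not parallel. Let $x,y:\mathbb{R}^2\to\mathbb{R}$ be the affine functions uniquely determined by $$L_j=\{x=0\},\quad L_{j+n}=\{x=1\},\quad L_i=\{y=0\},\quad L_{i+n}=\{y=1\}.$$ Write $p=(u,v)$ in these coordinates; then $0<u,v<1$. Put $S=L_i\cap L_j$, $S^*=L_{i+n}\cap L_{j+n}=(1,1)$, and define $A,B\in\mathbb{R}$ by $$\widetilde\sigma_i(S)=(1+A,1),\qquad \widetilde\sigma_j(S)=(1,1+B)$$ (in the coordinates $(x,y)$). Set $$\beta_{ij}(p)=AB-A\mu_jv-B\mu_iu.$$ This quantity is unchanged if $i$ and $j$ are interchanged. Then the cellwise envelope has exactly one of the following affine types: (a) if $\beta_{ij}(p)>0$, it is an arc of a non-degenerate ellipse; (b) if $\beta_{ij}(p)<0$, it is an arc of a non-degenerate hyperbola; (c) if $\beta_{ij}(p)=0$, all reflected lines in the cell are concurrent at the finite point $C_{ij}(p)$ determined by $$x\bigl(C_{ij}(p)\bigr)=1+A-\mu_iu,\qquad y\bigl(C_{ij}(p)\bigr)=1+B-\mu_jv,$$ and the cellwise envelope is that point. In particular, a parabolic cell and a one-dimensional degenerate cellwise envelope cannot occur. The point-degeneration criterion $\beta_{ij}(p)=0$ has the coordinate-free form $$[\widetilde\sigma_i^{-1}(S^* )-p,\ \widetilde\sigma_j^{-1}(S^* )-p]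=0.$$
   Context: A CPPOS (convex polygon with parallel opposite sides) is a positively oriented convex polygon $P=(P_0,\dots,P_{2n-1})$, indices modulo $2n$, all $P_i$ genuine vertices (consecutive edge vectors linearly independent), whose edge vectors $e_i=P_{i+1}-P_i$ satisfy $e_{i+n}=-\mu_ie_i$ with $\mu_i>0$ (so $\mu_{i+n}=\mu_i^{-1}$). $P$ also denotes the closed convex region it bounds. $L_i=P_i+\mathbb{R}e_i$ is the supporting line of the side $e_i=[P_i,P_{i+1}]$. Boundary involution: $\sigma_P:\partial P\to\partial P$, $\sigma_P(P_i+s e_i)=P_{i+n}+s e_{i+n}$, $0\le s\le1$. Its affine extension along the $i$th side is $\widetilde\sigma_i:L_i\to L_{i+n}$, $\widetilde\sigma_i(P_i+se_i)=P_{i+n}+se_{i+n}$, $s\in\mathbb{R}$. For a line $\ell$ meeting $\operatorname{int}(P)$ with boundary intersection points $x_\ell,y_\ell$, the reflected line is $\Phi_P(\ell)=\overline{\sigma_P(x_\ell)\sigma_P(y_\ell)}$. $\Lambda_p$ is the pencil of lines through $p$. The cell supported on $e_i$ and $e_j$ is the open arc of lines of $\Lambda_p$ whose two boundary intersection points lie in the open sides $e_i$ and $e_j$. The cellwise envelope is the envelope of the reflected lines $\Phi_P(\ell)$, $\ell$ in the cell (with homogeneous line coordinates $\boldsymbol\ell(s)\in\mathbb{R}^3$, the envelope point is $[\boldsymbol\ell\times\boldsymbol\ell']$). $[u,v]=\det(u,v)$ for $u,v\in\mathbb{R}^2$. *)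

(* Defs.v *)
From HB Require Import structures.
From mathcomp Require Export all_boot all_order all_algebra.
From mathcomp Require Export all_classical all_reals all_analysis.

Set Implicit Arguments.
Unset Strict Implicit.
Unset Printing Implicit Defensive.

Export Order.TTheory GRing.Theory Num.Theory.
Export numFieldNormedType.Exports.

Local Open Scope classical_set_scope.
Local Open Scope ring_scope.

Section PlaneAndProjectivePlane.
Context {R : realType}.

Definition det2 (u v : 'rV[R]_2) : R := u 0 0 * v 0 1 - u 0 1 * v 0 0.

Definition line (a b : 'rV[R]_2) : set 'rV[R]_2 :=
  [set q | exists s : R, q = a + s *: (b - a)].

Definition is_line (l : set 'rV[R]_2) : Prop :=
  exists a b, a != b /\ l = line a b.

Definition affine_fun (f : 'rV[R]_2 -> R) : Prop :=
  exists a b c : R, forall q, f q = a * q 0 0 + b * q 0 1 + c.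

Definition row3 (a b c : R) : 'rV[R]_3 := \row_k [:: a; b; c]`_k.

Definition cross (u v : 'rV[R]_3) : 'rV[R]_3 :=
  row3 (u 0 1 * v 0 2 - u 0 2 * v 0 1)
       (u 0 2 * v 0 0 - u 0 0 * v 0 2)
       (u 0 0 * v 0 1 - u 0 1 * v 0 0).

(* The affine line with homogeneous line coordinates [w]. *)
Definition hline (w : 'rV[R]_3) : set 'rV[R]_2 :=
  [set q | w 0 0 * q 0 0 + w 0 1 * q 0 1 + w 0 2 = 0].

(* Subsets of the real projective plane are represented by sets of homogeneous
   coordinate vectors that are stable under [proj_eq]; the affine plane is the
   part where the last coordinate is nonzero. *)
Definition proj_eq (w w' : 'rV[R]_3) : Prop :=
  exists k : R, k != 0 /\ w = k *: w'.

Definition hpoint (q : 'rV[R]_2) : set 'rV[R]_3 :=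
  [set w | proj_eq w (row3 (q 0 0) (q 0 1) 1)].

(* Matrices of affine bijections, acting on homogeneous rows by [w *m T]. *)
Definition affine_mx (T : 'M[R]_3) : Prop :=
  T \in unitmx /\ forall k : 'I_3, T k 2 = (k == 2)%:R.

(* Projective closures of the affine images of the curve whose homogenized
   equation is [std]. *)
Definition affine_image_of (std : 'rV[R]_3 -> Prop) (C : set 'rV[R]_3) : Prop :=
  exists T, affine_mx T /\ C = [set w | w != 0 /\ std (w *m T)].

Definition ellipse : set 'rV[R]_3 -> Prop :=
  affine_image_of (fun w => w 0 0 ^+ 2 + w 0 1 ^+ 2 = w 0 2 ^+ 2).

Definition hyperbola : set 'rV[R]_3 -> Prop :=
  affine_image_of (fun w => w 0 0 ^+ 2 - w 0 1 ^+ 2 = w 0 2 ^+ 2).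

Definition parabola : set 'rV[R]_3 -> Prop :=
  affine_image_of (fun w => w 0 0 ^+ 2 = w 0 1 * w 0 2).

(* Lines, pairs of lines, single points. *)
Definition degenerate_conic (C : set 'rV[R]_3) : Prop :=
  exists M : 'M[R]_3, [/\ M^T = M, M != 0, \det M = 0 &
    C = [set w | w != 0 /\ (w *m M *m w^T) 0 0 = 0]].

(* [E] is an arc lying on [C]: the image of a non-empty open interval under a
   map into the projective plane that is continuous (through a continuous
   nowhere vanishing lift [g]; vectors of [C] are nonzero) and injective. *)
Definition arc_on (C E : set 'rV[R]_3) : Prop :=
  exists (c d : R) (g : R -> 'rV[R]_3),
    [/\ c < d,
        forall t, c < t < d -> {for t, continuous g} /\ (g t != 0 /\ C (g t)),
        forall t t', c < t < d -> c < t' < d -> proj_eq (g t) (g t') -> t = t' &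
        E = [set w | exists2 t, c < t < d & proj_eq w (g t)]].

Definition arc_of (type : set 'rV[R]_3 -> Prop) (E : set 'rV[R]_3) : Prop :=
  exists2 C, type C & arc_on C E.

Definition is_finite_point (E : set 'rV[R]_3) : Prop := exists q, E = hpoint q.

End PlaneAndProjectivePlane.

Definition exactly_one (A B C : Prop) : Prop :=
  [\/ [/\ A, ~ B & ~ C], [/\ ~ A, B & ~ C] | [/\ ~ A, ~ B & C]].

Section Cppos.
Context {R : realType}.

(* Indices modulo [2n] are natural numbers, and the vertices form a
   [2n]-periodic sequence. *)
Implicit Types (P : nat -> 'rV[R]_2) (n i j : nat).

Definition edge P i : 'rV[R]_2 := P i.+1 - P i.

(* The third clause: all vertices other than the endpoints of the side [i] lie
   strictly to its left. The weak inequality would also allow polygons that are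
   traversed several times. *)
Definition cppos n P (mu : nat -> R) : Prop :=
  [/\ (1 < n)%N,
      forall i, P (i + n.*2)%N = P i,
      forall i k, (k != i %[mod n.*2])%N -> (k != i.+1 %[mod n.*2])%N ->
        0 < det2 (edge P i) (P k - P i),
      forall i, det2 (edge P i) (edge P i.+1) != 0 &
      forall i, 0 < mu i /\ edge P (i + n) = - mu i *: edge P i].

Definition region P : set 'rV[R]_2 :=
  [set q | forall i, 0 <= det2 (edge P i) (q - P i)].

Definition side P i : set 'rV[R]_2 :=
  [set q | exists2 s : R, 0 <= s <= 1 & q = P i + s *: edge P i].

Definition open_side P i : set 'rV[R]_2 :=
  [set q | exists2 s : R, 0 < s < 1 & q = P i + s *: edge P i].

Definition polygon_boundary P : set 'rV[R]_2 := \bigcup_i side P i.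

Definition side_line P i : set 'rV[R]_2 :=
  [set q | exists s : R, q = P i + s *: edge P i].

(* Graph of the boundary involution. *)
Definition sigma P n (q q' : 'rV[R]_2) : Prop :=
  exists (i : nat) (s : R), [/\ 0 <= s <= 1,
    q = P i + s *: edge P i & q' = P (i + n)%N + s *: edge P (i + n)%N].

(* Graph of its affine extension along the [i]th side. *)
Definition sigma_ext P n i (q q' : 'rV[R]_2) : Prop :=
  exists s : R,
    q = P i + s *: edge P i /\ q' = P (i + n)%N + s *: edge P (i + n)%N.

(* Graph of the line reflection: [m] is the reflected line of [l]. *)
Definition reflected P n (l m : set 'rV[R]_2) : Prop :=
  [/\ is_line l, l `&` (region P)° !=set0 &
   exists x y x' y', [/\ x != y, l `&` polygon_boundary P = [set x; y],
     sigma P n x x', sigma P n y y' & m = line x' y']].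

Definition pencil (p : 'rV[R]_2) : set (set 'rV[R]_2) :=
  [set l | is_line l /\ l p].

Definition cell P (p : 'rV[R]_2) i j : set (set 'rV[R]_2) :=
  [set l | pencil p l /\ exists x y, [/\ open_side P i x, open_side P j y &
     l `&` polygon_boundary P = [set x; y]]].

(* On the interval ]c, d[, [lam] gives line coordinates of a regular
   parametrization of the whole cell and [ell] gives line coordinates of the
   reflected lines. Regularity is [lam s] and [lam' s] being independent; it does
   not depend on the scaling of the lift [lam]. *)
Definition cell_parametrization P n (p : 'rV[R]_2) i j (c d : R)
    (lam ell : R -> 'rV[R]_3) : Prop :=
  [/\ c < d,
      forall s, c < s < d ->
        [/\ derivable lam s 1, cross (lam s) (derive1 lam s) != 0 &
            cell P p i j (hline (lam s))],
      forall l, cell P p i j l -> exists2 s, c < s < d & l = hline (lam s) &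
      forall s, c < s < d ->
        derivable ell s 1 /\ reflected P n (hline (lam s)) (hline (ell s))].

(* [E] is the cellwise envelope, as a subset of the projective plane. *)
Definition cellwise_envelope P n (p : 'rV[R]_2) i j (E : set 'rV[R]_3) : Prop :=
  exists c d lam ell, cell_parametrization P n p i j c d lam ell /\
    E = [set w | exists2 s, c < s < d &
                   proj_eq w (cross (ell s) (derive1 ell s))].

Record frame := Frame {
  fx : 'rV[R]_2 -> R;
  fy : 'rV[R]_2 -> R;
  fS : 'rV[R]_2;
  fSstar : 'rV[R]_2;
  fA : R;
  fB : R }.

Definition is_frame P n i j (F : frame) : Prop :=
  [/\ [/\ affine_fun (fx F),
          side_line P j = [set q | fx F q = 0] &
          side_line P (j + n)%N = [set q | fx F q = 1]],
      [/\ affine_fun (fy F),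
          side_line P i = [set q | fy F q = 0] &
          side_line P (i + n)%N = [set q | fy F q = 1]],
      side_line P i `&` side_line P j = [set fS F] /\
      side_line P (i + n)%N `&` side_line P (j + n)%N = [set fSstar F],
      exists q, [/\ sigma_ext P n i (fS F) q, fx F q = 1 + fA F & fy F q = 1] &
      exists q, [/\ sigma_ext P n j (fS F) q, fx F q = 1 & fy F q = 1 + fB F]].

Definition beta_ij (mu : nat -> R) i j (p : 'rV[R]_2) (F : frame) : R :=
  fA F * fB F - fA F * mu j * fy F p - fB F * mu i * fx F p.

End Cppos.

(* Main.v *)
Require Import Defs.
From mathcomp Require Import ring lra zify.

Set Implicit Arguments.
Unset Strict Implicit.
Unset Printing Implicit Defensive.

Local Open Scope classical_set_scope.
Local Open Scope ring_scope.

(** In the coordinates [(x, y)] of the frame the sides [i] and [i + n] lie on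
    [y = 0] and [y = 1], the sides [j] and [j + n] on [x = 0] and [x = 1], and
    opposite sides being parallel, the boundary involution acts by
    [(x, 0) |-> (1 + A - mu_i x, 1)] and [(0, y) |-> (1, 1 + B - mu_j y)].
    A line through [p = (u, v)] that meets [L_i] at [(u + t, 0)] meets [L_j] at
    [(0, v + u v / t)], so the cell is an interval of values [t > 0].  Put
    [m = mu_i], [K = mu_j u v], [a = A - m u], [b = B - mu_j v], and move the
    origin to the point [C = (1 + a, 1 + b)].  The reflected line joins
    [(- m t, - b)] to [(- a, - K / t)], so its line coordinates
    [((b t - K), (a - m t) t, be t)], with [be = a b - m K = beta_ij(p)], are
    quadratic polynomials in [t].

    The cross product of this lift with its derivative is the curve
    [envelope_pt].  A lift of the reflected lines coming from another
    parametrization of the cell only multiplies it by a nonzero scalar, so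
    [envelope_arc] is the cellwise envelope ([envelope_unique]).

    If [be = 0], every reflected line passes through [C].  The cross product
    still does not vanish: the reflected points lie on open sides, hence
    strictly inside the lines [x = 1] and [y = 1], so [a - m t] and [b t - K]
    are negative ([cell_param_signs]).  The envelope is then the point [C].

    If [be <> 0], eliminating [t] gives the conic
    [(b X + a Y + be W)^2 = 4 m K X Y], and completing squares
    ([envelope_conic]) shows an ellipse for [be > 0] and a hyperbola for
    [be < 0].  Conversely this is the only conic through an arc of the curve
    ([conic_through_arc]), and the discriminant of its restriction to the line
    at infinity is [16 m K be], so no other affine type is possible.

    Finally, the point [(1, 1)] is the image of [(A / mu_i, 0)] along the side
    [i] and of [(0, B / mu_j)] along the side [j], and the determinant of the
    differences of these two points with [p] is [be / (mu_i mu_j)] up to the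
    area factor of the frame. *)

(** * The projective plane in homogeneous coordinates *)

Section ProjectivePlane.
Context {R : realType}.
Implicit Types (a b q : 'rV[R]_2) (u v w : 'rV[R]_3) (N : 'M[R]_3).

Lemma sum3E (f : 'I_3 -> R) : \sum_k f k = f 0 + f 1 + f 2.
Proof.
rewrite !big_ord_recl big_ord0 addr0 addrA.
by congr (_ + f _ + f _); apply/val_inj.
Qed.

Lemma row3E (x y z : R) :
  (row3 x y z 0 0 = x) * (row3 x y z 0 1 = y) * (row3 x y z 0 2 = z).
Proof. by rewrite /row3 !mxE. Qed.

Lemma ord3P (k : 'I_3) : [\/ k = 0, k = 1 | k = 2].
Proof.
by case: k => -[|[|[|//]]] lt_k; [constructor 1|constructor 2|constructor 3];
  exact: val_inj.
Qed.

Lemma row3P u v :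
  u 0 0 = v 0 0 -> u 0 1 = v 0 1 -> u 0 2 = v 0 2 -> u = v.
Proof.
by move=> e0 e1 e2; apply/rowP => k; case: (ord3P k) => ->.
Qed.

Lemma row2P a b : a 0 0 = b 0 0 -> a 0 1 = b 0 1 -> a = b.
Proof.
move=> e0 e1; apply/rowP => -[[|[|//]] lt_k].
- by rewrite (_ : Ordinal lt_k = 0) //; apply/val_inj.
- by rewrite (_ : Ordinal lt_k = 1) //; apply/val_inj.
Qed.

Lemma mulrow3E u N k :
  (u *m N) 0 k = u 0 0 * N 0 k + u 0 1 * N 1 k + u 0 2 * N 2 k.
Proof. by rewrite mxE sum3E. Qed.

Lemma det3E N : \det N =
  N 0 0 * (N 1 1 * N 2 2 - N 1 2 * N 2 1)
  - N 0 1 * (N 1 0 * N 2 2 - N 1 2 * N 2 0)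
  + N 0 2 * (N 1 0 * N 2 1 - N 1 1 * N 2 0).
Proof.
have det2E (M : 'M[R]_2) : \det M = M 0 0 * M 1 1 - M 0 1 * M 1 0.
  rewrite (expand_det_row _ 0) !big_ord_recl big_ord0 /cofactor !det_mx11.
  rewrite !mxE /= expr0 expr1 (_ : lift 0 0 = 1); last exact/val_inj.
  by rewrite (_ : lift 1 0 = 0); [ring|exact/val_inj].
rewrite (expand_det_row _ 0) sum3E /cofactor !det2E !mxE.
have l00 : lift 0 0 = 1 :> 'I_3 by exact/val_inj.
have l01 : lift 0 1 = 2 :> 'I_3 by exact/val_inj.
have l10 : lift 1 0 = 0 :> 'I_3 by exact/val_inj.
have l11 : lift 1 1 = 2 :> 'I_3 by exact/val_inj.
have l20 : lift 2 0 = 0 :> 'I_3 by exact/val_inj.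
have l21 : lift 2 1 = 1 :> 'I_3 by exact/val_inj.
rewrite !l00 !l01 !l10 !l11 !l20 !l21 /=.
by ring.
Qed.

(** A change of coordinates that acts on points by [N] acts on line coordinates
    by the transposed inverse.  Intersecting two lines therefore commutes with
    it, up to the scalar [\det N] by which the cofactors differ from the
    inverse. *)
Lemma cross_mulmx N u v :
  cross (u *m N^T) (v *m N^T) *m N = \det N *: cross u v.
Proof.
by apply: row3P; rewrite !mulrow3E [RHS]mxE /cross !row3E !mulrow3E !mxE det3E;
  ring.
Qed.

Definition hom q : 'rV[R]_3 := row3 (q 0 0) (q 0 1) 1.

Definition pairing u w : R := u 0 0 * w 0 0 + u 0 1 * w 0 1 + u 0 2 * w 0 2.

Lemma hlineE w q : hline w q = (pairing (hom q) w = 0).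
Proof.
by rewrite /hline /= /pairing /hom !row3E mul1r ![w 0 _ * q _ _]mulrC.
Qed.

Lemma pairing_mulmx N u w : pairing (u *m N) w = pairing u (w *m N^T).
Proof. by rewrite /pairing !mulrow3E !mxE; ring. Qed.

Lemma pairing_cancel N u w : N \in unitmx ->
  pairing (u *m N) (w *m (invmx N)^T) = pairing u w.
Proof. by move=> uN; rewrite -pairing_mulmx mulmxK. Qed.

Lemma proj_eq_refl u : proj_eq u u.
Proof. by exists 1; rewrite scale1r oner_neq0. Qed.

Lemma proj_eq_sym u v : proj_eq u v -> proj_eq v u.
Proof.
move=> [k [k0 ->]]; exists k^-1; rewrite invr_neq0 //; split=> //.
by rewrite scalerA mulVf // scale1r.
Qed.

Lemma proj_eq_trans v u w : proj_eq u v -> proj_eq v w -> proj_eq u w.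
Proof.
move=> [k [k0 ->]] [l [l0 ->]]; exists (k * l); rewrite mulf_neq0 //; split=> //.
by rewrite scalerA.
Qed.

Lemma proj_eq_mulmx N u v : N \in unitmx ->
  proj_eq (u *m N) (v *m N) <-> proj_eq u v.
Proof.
move=> uN; split=> -[k [k0 e]]; exists k; split=> //; last by rewrite e scalemxAl.
by rewrite -[u](mulmxK uN) e -scalemxAl mulmxK.
Qed.

Lemma line_hline w a b : (w 0 0 != 0) || (w 0 1 != 0) ->
  a != b -> hline w a -> hline w b -> line a b = hline w.
Proof.
rewrite /hline /= => w0 nab ha hb.
have ha2 : w 0 2 = - (w 0 0 * a 0 0 + w 0 1 * a 0 1).
  by apply/eqP; rewrite -addr_eq0 addrC ha.
have hba : w 0 0 * (b 0 0 - a 0 0) + w 0 1 * (b 0 1 - a 0 1) = 0.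
  by move: hb; rewrite ha2 => hb; rewrite -hb; ring.
apply/seteqP; split=> q /=.
  move=> [s ->]; rewrite !mxE ha2; transitivity
    (s * (w 0 0 * (b 0 0 - a 0 0) + w 0 1 * (b 0 1 - a 0 1))); first by ring.
  by rewrite hba mulr0.
rewrite ha2 => hq.
have hqa : w 0 0 * (q 0 0 - a 0 0) + w 0 1 * (q 0 1 - a 0 1) = 0.
  by rewrite -hq; ring.
have hd : (b 0 0 - a 0 0) * (q 0 1 - a 0 1) = (b 0 1 - a 0 1) * (q 0 0 - a 0 0).
  case/orP: w0 => w0; apply: (mulfI w0).
    apply/eqP; rewrite -subr_eq0; apply/eqP; transitivity
      ((w 0 0 * (b 0 0 - a 0 0) + w 0 1 * (b 0 1 - a 0 1)) * (q 0 1 - a 0 1) -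
       (w 0 0 * (q 0 0 - a 0 0) + w 0 1 * (q 0 1 - a 0 1)) * (b 0 1 - a 0 1)).
      by ring.
    by rewrite hba hqa; ring.
  apply/eqP; rewrite -subr_eq0; apply/eqP; transitivity
    ((w 0 0 * (q 0 0 - a 0 0) + w 0 1 * (q 0 1 - a 0 1)) * (b 0 0 - a 0 0) -
     (w 0 0 * (b 0 0 - a 0 0) + w 0 1 * (b 0 1 - a 0 1)) * (q 0 0 - a 0 0)).
    by ring.
  by rewrite hba hqa; ring.
have [d0|d0] := eqVneq (b 0 0 - a 0 0) 0; last first.
  exists ((q 0 0 - a 0 0) / (b 0 0 - a 0 0)); apply: row2P; rewrite !mxE.
    by field.
  have -> : q 0 1 = a 0 1 + (b 0 1 - a 0 1) * (q 0 0 - a 0 0) / (b 0 0 - a 0 0).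
    by rewrite -hd; field.
  by field.
have d1 : b 0 1 - a 0 1 != 0.
  apply: contraNneq nab => d1; apply/eqP/row2P; apply/esym/eqP.
    by rewrite -subr_eq0 d0.
  by rewrite -subr_eq0 d1.
exists ((q 0 1 - a 0 1) / (b 0 1 - a 0 1)); apply: row2P; rewrite !mxE; last by field.
move: hd; rewrite d0 mul0r mulr0 addr0 => /esym/eqP.
by rewrite mulf_eq0 (negPf d1) /= subr_eq0 => /eqP.
Qed.

Lemma affine_mxM (N M : 'M[R]_3) :
  affine_mx N -> affine_mx M -> affine_mx (N *m M).
Proof.
move=> [uN cN] [uM cM]; split=> [|k]; first by rewrite unitmx_mul uN.
by rewrite mxE sum3E !cM /= !cN mulr0 mulr0 mulr1 !add0r.
Qed.

Lemma affine_mxV N : affine_mx N -> affine_mx (invmx N).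
Proof.
move=> [uN cN]; split=> [|k]; first by rewrite unitmx_inv.
have e2 M : M *m (delta_mx 2 0 : 'cV[R]_3) = col 2 M by rewrite -colE.
have : invmx N *m (N *m (delta_mx 2 0 : 'cV[R]_3)) = delta_mx 2 0.
  by rewrite mulKmx.
rewrite e2 (_ : col 2 N = delta_mx 2 0); last first.
  by apply/matrixP => l z; rewrite !mxE cN ord1 eqxx andbT.
by rewrite e2 => /matrixP/(_ k 0); rewrite !mxE eqxx andbT.
Qed.

End ProjectivePlane.

(** * The normal form of the reflected lines and of their envelope *)

Section NormalForm.
Context {R : realType}.
Implicit Types (m K a b t : R) (u v w : 'rV[R]_3).

(** The reflected line, in the coordinates centred at [C]. *)
Definition refl_line m K a b t : 'rV[R]_3 :=
  row3 (b * t - K) ((a - m * t) * t) ((a * b - m * K) * t).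

(** The cross product of [refl_line] with its derivative in [t]. *)
Definition envelope_pt m K a b t : 'rV[R]_3 :=
  row3 ((a * b - m * K) * m * t ^+ 2) ((a * b - m * K) * K)
       (2 * m * K * t - m * b * t ^+ 2 - a * K).

(** The two linear conditions on [u] say that the line passes through the points
    [(- m t, - b)] and [(- a, - K / t)]. *)
Lemma refl_line_through m K a b t u :
  b * t - K != 0 ->
  u 0 2 = m * t * u 0 0 + b * u 0 1 ->
  t * u 0 2 = a * t * u 0 0 + K * u 0 1 ->
  u = (u 0 0 / (b * t - K)) *: refl_line m K a b t.
Proof.
move=> d0 e1 e2.
have e3 : u 0 1 = u 0 0 / (b * t - K) * ((a - m * t) * t).
  apply: (mulfI d0); rewrite -[LHS]addr0.
  rewrite -(subrr (t * u 0 2)) [in X in _ + (X - _)]e2 e1; field.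
  exact: d0.
apply: row3P; rewrite mxE row3E; [by field|exact: e3|].
by rewrite e1 e3; field.
Qed.

(** The line coordinates [u], their derivative [u'] and the derivative [t'] of
    the parameter enter through the incidence conditions and the differentiated
    incidence conditions alone.  These force [u = k l] and
    [u' = x l + k t' l'] for some [x], where [l] is [refl_line] and [l'] its
    derivative, and the term in [x] drops out of the cross product. *)
Lemma cross_refl_line m K a b t t' u u' :
  b * t - K != 0 ->
  u 0 2 = m * t * u 0 0 + b * u 0 1 ->
  t * u 0 2 = a * t * u 0 0 + K * u 0 1 ->
  u' 0 2 = m * t * u' 0 0 + m * t' * u 0 0 + b * u' 0 1 ->
  t * u' 0 2 + t' * u 0 2 = a * t * u' 0 0 + a * t' * u 0 0 + K * u' 0 1 ->
  cross u u' =
    ((u 0 0 / (b * t - K)) ^+ 2 * t') *: envelope_pt m K a b t.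
Proof.
move=> d0 e1 e2 e1' e2'.
have := refl_line_through d0 e1 e2; set k := _ / _ => eu.
have u0 : u 0 0 = k * (b * t - K) by rewrite {1}eu mxE row3E.
have u1 : u 0 1 = k * ((a - m * t) * t) by rewrite {1}eu mxE row3E.
have u2 : u 0 2 = k * ((a * b - m * K) * t) by rewrite {1}eu mxE row3E.
(* The derivative of the factor [k]. *)
pose x := (u' 0 0 - k * b * t') / (b * t - K).
have v0 : u' 0 0 = x * (b * t - K) + k * b * t' by rewrite /x; field.
have v1 : u' 0 1 = x * ((a - m * t) * t) + k * (a - 2 * m * t) * t'.
  apply: (mulfI d0); rewrite -[LHS]addr0.
  rewrite -(subrr (t * u' 0 2 + t' * u 0 2)) [in X in _ + (X - _)]e2' e1'.
  by rewrite u0 u2 v0; ring.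
have v2 : u' 0 2 = x * ((a * b - m * K) * t) + k * (a * b - m * K) * t'.
  by rewrite e1' v0 v1 u0; ring.
by apply: row3P; rewrite [RHS]mxE /cross !row3E ?u0 ?u1 ?u2 ?v0 ?v1 ?v2; ring.
Qed.

Lemma poly_eq0_itv (p : {poly R}) (c d : R) : c < d ->
  (forall t, c < t < d -> p.[t] = 0) -> p = 0.
Proof.
move=> cd hp; apply: contraTeq isT => p0.
(* [size p] distinct roots in the interval. *)
pose f k : R := c + (d - c) / k.+2%:R.
have d0 : 0 < d - c by rewrite subr_gt0.
have : (size (map f (iota 0 (size p))) < size p)%N.
  apply: max_poly_roots => //.
    apply/allP => _ /mapP[k _ ->]; rewrite rootE hp // /f ltrDl.
    rewrite divr_gt0 //= -ltrBrDl ltr_pdivrMr // ltr_pMr // ltr1n //.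
  rewrite map_inj_uniq ?iota_uniq // => k l /addrI /(mulfI (lt0r_neq0 d0)).
  by move=> /invr_inj /eqP; rewrite eqr_nat => /eqP [].
by rewrite size_map size_iota ltnn.
Qed.

(** Along the curve the equation of a conic becomes a quartic polynomial in the
    parameter.  If it vanishes on an interval, its five coefficients are zero,
    which determines the six coefficients of the conic up to the factor [F]: the
    equation is a multiple of [(b X + a Y + be W)^2 = 4 m K X Y]. *)
Lemma conic_through_arc m K a b (A B C D E F c d : R) :
  let be := a * b - m * K in
  m != 0 -> K != 0 -> be != 0 -> c < d ->
  (forall t, c < t < d -> let w := envelope_pt m K a b t in
     A * w 0 0 ^+ 2 + B * (w 0 0 * w 0 1) + C * w 0 1 ^+ 2 +
     D * (w 0 0 * w 0 2) + E * (w 0 1 * w 0 2) + F * w 0 2 ^+ 2 = 0) ->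
  [/\ be ^+ 2 * A = F * b ^+ 2, be ^+ 2 * B = F * (2 * a * b - 4 * m * K),
      be ^+ 2 * C = F * a ^+ 2, be * D = 2 * F * b & be * E = 2 * F * a].
Proof.
move=> be m0 K0 be0 cd h.
pose p := Poly [:: K ^+ 2 * (be ^+ 2 * C - be * E * a + F * a ^+ 2);
  2 * m * K ^+ 2 * (be * E - 2 * F * a);
  m * K * (be ^+ 2 * B - be * D * a - be * E * b + F * (4 * m * K + 2 * a * b));
  2 * m ^+ 2 * K * (be * D - 2 * F * b);
  m ^+ 2 * (be ^+ 2 * A - be * D * b + F * b ^+ 2)].
have p0 : p = 0.
  apply: (poly_eq0_itv cd) => t /h <-; rewrite horner_Poly /= !row3E.
  by rewrite -/be; ring.
have hc k : p`_k = 0 by rewrite p0 coef0.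
have := (hc 0%N, hc 1%N, hc 2%N, hc 3%N, hc 4%N).
rewrite !coef_Poly /= => -[[[[h0 h1] h2] h3] h4].
have cancel (x y : R) : x != 0 -> x * y = 0 -> y = 0.
  by move=> x0 /eqP; rewrite mulf_eq0 (negPf x0) => /eqP.
have two0 : 2 != 0 :> R by rewrite pnatr_eq0.
have {}h3 : be * D = 2 * F * b.
  apply/eqP; rewrite -subr_eq0; apply/eqP; apply: cancel h3.
  by rewrite !mulf_neq0 // expf_neq0.
have {}h1 : be * E = 2 * F * a.
  apply/eqP; rewrite -subr_eq0; apply/eqP; apply: cancel h1.
  by rewrite !mulf_neq0 // expf_neq0.
move: (cancel _ _ (expf_neq0 2 K0) h0) (cancel _ _ (expf_neq0 2 m0) h4).
move: (cancel _ _ (mulf_neq0 m0 K0) h2).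
rewrite h1 h3 => {}h2 {}h0 {}h4.
split=> //; apply/eqP; rewrite -subr_eq0; apply/eqP.
- by rewrite -h4; ring.
- by rewrite -h2; ring.
- by rewrite -h0; ring.
Qed.

End NormalForm.

(** * The conics through an arc of the envelope *)

Section Types.
Context {R : realType}.
Implicit Types (m K a b t c d : R) (u v w f g : 'rV[R]_3) (N T : 'M[R]_3).

(** Every affine change of coordinates has this form ([affine_mxE]); the new
    coordinates are the affine functions with coefficients [f] and [g]. *)
Definition affmx f g : 'M[R]_3 :=
  \matrix_(k, l) [:: f 0 k; g 0 k; (k == 2)%:R]`_l.

Lemma mulmx_affmx u f g :
  u *m affmx f g = row3 (pairing u f) (pairing u g) (u 0 2).
Proof.
apply: row3P; rewrite mulrow3E !row3E !mxE /= ?mulr0 ?add0r ?mulr1 //.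
Qed.

Lemma affine_mx_affmx f g :
  f 0 0 * g 0 1 - f 0 1 * g 0 0 != 0 -> affine_mx (affmx f g).
Proof.
move=> h; split=> [|k]; last by rewrite mxE.
rewrite unitmxE det3E !mxE /= unitfE.
by rewrite (_ : _ + _ = f 0 0 * g 0 1 - f 0 1 * g 0 0) //; ring.
Qed.

Definition envelope_arc N m K a b c d : set 'rV[R]_3 :=
  [set w | exists2 t, c < t < d & proj_eq w (envelope_pt m K a b t *m invmx N)].

Lemma envelope_arc_mem N m K a b c d t : c < t < d ->
  envelope_arc N m K a b c d (envelope_pt m K a b t *m invmx N).
Proof. by move=> ht; exists t => //; exact: proj_eq_refl. Qed.

Lemma continuous_envelope_pt N m K a b t :
  {for t, continuous (fun t => envelope_pt m K a b t *m N)}.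
Proof.
pose w0 : 'rV[R]_3 := row3 0 ((a * b - m * K) * K) (- (a * K)) *m N.
pose w1 : 'rV[R]_3 := row3 0 0 (2 * m * K) *m N.
pose w2 : 'rV[R]_3 := row3 ((a * b - m * K) * m) 0 (- (m * b)) *m N.
rewrite (_ : (fun t => _) = fun s : R => s *: (s *: w2) + s *: w1 + w0).
  apply: cvgD; last exact: cvg_cst.
  apply: cvgD; last by apply: cvgZ; [exact: cvg_id|exact: cvg_cst].
  by apply: cvgZ; [exact: cvg_id|apply: cvgZ; [exact: cvg_id|exact: cvg_cst]].
apply/funext => s; rewrite !scalemxAl -!mulmxDl; congr (_ *m N).
by apply: row3P; rewrite !mxE /= ?row3E; ring.
Qed.

Lemma envelope_pt_inj m K a b t t' : 0 < m -> 0 < K -> a * b - m * K != 0 ->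
  0 < t -> 0 < t' ->
  proj_eq (envelope_pt m K a b t) (envelope_pt m K a b t') -> t = t'.
Proof.
move=> m0 K0 be0 t0 t0' [k [k0 /rowP e]].
have := e 1; rewrite !mxE /= => /esym/eqP.
rewrite -subr_eq0 -[X in _ - X]mul1r -mulrBl mulf_eq0 subr_eq0.
rewrite (negPf (mulf_neq0 be0 (lt0r_neq0 K0))) orbF => /eqP k1.
have := e 0; rewrite !mxE /= k1 mul1r.
move=> /(mulfI (mulf_neq0 be0 (lt0r_neq0 m0))) /eqP.
by rewrite eqrXn2 // ?ltW // => /eqP.
Qed.

Lemma envelope_pt_neq0 m K a b t : 0 < K -> a * b - m * K != 0 ->
  envelope_pt m K a b t != 0.
Proof.
move=> K0 be0; apply: contraTneq isT => /rowP/(_ 1); rewrite !mxE /= => /eqP.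
by rewrite mulf_eq0 (negPf be0) (gt_eqF K0).
Qed.

Lemma mulmx_unit_eq0 u N : N \in unitmx -> (u *m N == 0) = (u == 0).
Proof.
move=> uN; apply/eqP/eqP => [e|->]; last by rewrite mul0mx.
by rewrite -[u](mulmxK uN) e mul0mx.
Qed.

Lemma proj_eq_neq0 w w' : proj_eq w w' -> w' != 0 -> w != 0.
Proof. by move=> [k [k0 ->]]; rewrite scaler_eq0 negb_or k0. Qed.

Lemma arc_on_sub (C E : set 'rV[R]_3) :
  (forall w w', proj_eq w w' -> C w' -> C w) -> arc_on C E -> E `<=` C.
Proof.
move=> hC [c [d [g [_ hg _ ->]]]] w [t ht e]; apply: hC e _.
by have [_ []] := hg t ht.
Qed.

Lemma affine_image_proj_eq (std : 'rV[R]_3 -> Prop) C :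
  (forall k w, k != 0 -> std w -> std (k *: w)) -> affine_image_of std C ->
  forall w w', proj_eq w w' -> C w' -> C w.
Proof.
move=> hstd [T [_ ->]] w w' ww' [w'0 sw']; split.
  exact: proj_eq_neq0 ww' w'0.
by have [k [k0 ->]] := ww'; rewrite -scalemxAl; exact: hstd.
Qed.

Lemma affine_mxE M : affine_mx M ->
  exists f g, f 0 0 * g 0 1 - f 0 1 * g 0 0 != 0 /\ M = affmx f g.
Proof.
move=> [uM cM]; exists (col 0 M)^T, (col 1 M)^T; split.
  move: uM; rewrite unitmxE unitfE det3E !cM /= !mxE => /eqP h; apply/eqP => h'.
  by apply: h; rewrite -h'; ring.
apply/matrixP => k l; rewrite [RHS]mxE.
case: (ord3P l) => ->.
- by rewrite /= [RHS]mxE [RHS]mxE.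
- by rewrite /= [RHS]mxE [RHS]mxE.
- by rewrite cM.
Qed.

(** Transported to the coordinates of the frame, an affine image of a standard
    curve has the equation [std] in two independent affine functions [f] and
    [g]. *)
Lemma conic_image_arc (std : 'rV[R]_3 -> Prop) N m K a b c d :
  (forall k w, k != 0 -> std w -> std (k *: w)) -> affine_mx N ->
  arc_of (affine_image_of std) (envelope_arc N m K a b c d) ->
  exists f g, f 0 0 * g 0 1 - f 0 1 * g 0 0 != 0 /\
    forall t, c < t < d -> let w := envelope_pt m K a b t in
      std (row3 (pairing w f) (pairing w g) (w 0 2)).
Proof.
move=> hstd aN [C imC arcC].
have sub := arc_on_sub (affine_image_proj_eq hstd imC) arcC.
have [T [aT eC]] := imC.
have [f [g [det0 eM]]] := affine_mxE (affine_mxM (affine_mxV aN) aT).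
exists f, g; split=> // t ht w; rewrite -mulmx_affmx -eM.
have := sub _ (envelope_arc_mem N m K a b ht); rewrite eC => -[_].
by rewrite -mulmxA.
Qed.

Section Discriminant.
Variables (N : 'M[R]_3) (m K a b c d : R).
Hypotheses (aN : affine_mx N) (m0 : 0 < m) (K0 : 0 < K).
Hypotheses (be0 : a * b - m * K != 0) (cd : c < d).
Let be := a * b - m * K.
Let E := envelope_arc N m K a b c d.

(** The restriction of a conic to the line at infinity is the binary form
    [A X^2 + B X Y + C Y^2], whose discriminant separates the affine types. *)
Lemma discriminant_through_arc (A B C D E' F : R) :
  (forall t, c < t < d -> let w := envelope_pt m K a b t in
     A * w 0 0 ^+ 2 + B * (w 0 0 * w 0 1) + C * w 0 1 ^+ 2 +
     D * (w 0 0 * w 0 2) + E' * (w 0 1 * w 0 2) + F * w 0 2 ^+ 2 = 0) ->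
  be ^+ 4 * (4 * A * C - B ^+ 2) = 16 * F ^+ 2 * (m * K) * be /\
  (F = 0 -> [/\ A = 0, B = 0, C = 0, D = 0 & E' = 0]).
Proof.
move=> h.
have [hA hB hC hD hE] :=
  conic_through_arc (lt0r_neq0 m0) (lt0r_neq0 K0) be0 cd h.
split.
  transitivity (4 * (be ^+ 2 * A) * (be ^+ 2 * C) - (be ^+ 2 * B) ^+ 2).
    by ring.
  by rewrite hA hB hC /be; ring.
have cancel (x y : R) : x != 0 -> x * y = 0 -> y = 0.
  by move=> x0 /eqP; rewrite mulf_eq0 (negPf x0) => /eqP.
move=> F0; rewrite F0 ?(mulr0, mul0r) in hA hB hC hD hE.
have be2 := expf_neq0 2 be0.
by split; [exact: cancel hA|exact: cancel hB|exact: cancel hC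
  |exact: cancel hD|exact: cancel hE].
Qed.

(** The binary form of an affine image of the unit circle is positive definite,
    and that of an affine image of a standard hyperbola is indefinite: their
    discriminants are [4] and [-4] times the squared determinant of the linear
    part. *)
Lemma arc_of_ellipse_gt0 : arc_of ellipse E -> 0 < be.
Proof.
move/conic_image_arc; case=> //.
  by move=> k w _ h; rewrite !mxE !exprMn -mulrDr h.
move=> f [g [det0 h]].
have [|] := @discriminant_through_arc
  (f 0 0 ^+ 2 + g 0 0 ^+ 2) (2 * (f 0 0 * f 0 1 + g 0 0 * g 0 1))
  (f 0 1 ^+ 2 + g 0 1 ^+ 2) (2 * (f 0 0 * f 0 2 + g 0 0 * g 0 2))
  (2 * (f 0 1 * f 0 2 + g 0 1 * g 0 2)) (f 0 2 ^+ 2 + g 0 2 ^+ 2 - 1).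
  move=> t /h /=; rewrite !row3E /pairing ?row3E => /eqP; rewrite -subr_eq0 => /eqP <-.
  by ring.
set F := _ - 1 => e _; rewrite ltNge; apply/negP => be_le0.
have : 0 < be ^+ 4 * (4 * (f 0 0 * g 0 1 - f 0 1 * g 0 0) ^+ 2).
  by apply: mulr_gt0; rewrite ?exprn_even_gt0 //= pmulr_rgt0 // exprn_even_gt0.
have : 16 * F ^+ 2 * (m * K) * be <= 0.
  apply: mulr_ge0_le0 => //; apply: mulr_ge0; last by rewrite ltW ?mulr_gt0.
  by rewrite pmulr_rge0 ?sqr_ge0.
rewrite -e => le0 gt0; suff : 0 < 0 :> R by rewrite ltxx.
apply: lt_le_trans gt0 _; apply: le_trans le0; rewrite le_eqVlt; apply/orP; left.
by apply/eqP; ring.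
Qed.

Lemma arc_of_hyperbola_lt0 : arc_of hyperbola E -> be < 0.
Proof.
move/conic_image_arc; case=> //.
  by move=> k w _ h; rewrite !mxE !exprMn -mulrBr h.
move=> f [g [det0 h]].
have [|] := @discriminant_through_arc
  (f 0 0 ^+ 2 - g 0 0 ^+ 2) (2 * (f 0 0 * f 0 1 - g 0 0 * g 0 1))
  (f 0 1 ^+ 2 - g 0 1 ^+ 2) (2 * (f 0 0 * f 0 2 - g 0 0 * g 0 2))
  (2 * (f 0 1 * f 0 2 - g 0 1 * g 0 2)) (f 0 2 ^+ 2 - g 0 2 ^+ 2 - 1).
  move=> t /h /=; rewrite !row3E /pairing ?row3E => /eqP; rewrite -subr_eq0 => /eqP <-.
  by ring.
set F := _ - 1 => e _; rewrite ltNge; apply/negP => be_ge0.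
have : 0 < be ^+ 4 * (4 * (f 0 0 * g 0 1 - f 0 1 * g 0 0) ^+ 2).
  by apply: mulr_gt0; rewrite ?exprn_even_gt0 //= pmulr_rgt0 // exprn_even_gt0.
have : 0 <= 16 * F ^+ 2 * (m * K) * be.
  apply: mulr_ge0 => //; apply: mulr_ge0; last by rewrite ltW ?mulr_gt0.
  by rewrite pmulr_rge0 ?sqr_ge0.
rewrite -e => ge0 gt0; suff : 0 < 0 :> R by rewrite ltxx.
rewrite -oppr_lt0 in gt0.
apply: le_lt_trans ge0 _; apply: le_lt_trans gt0; rewrite le_eqVlt.
by apply/orP; left; apply/eqP; ring.
Qed.

Lemma discriminant_eq0 (F : R) : 16 * F ^+ 2 * (m * K) * be = 0 -> F = 0.
Proof.
move/eqP; rewrite !mulf_eq0 (negPf be0) (gt_eqF m0) (gt_eqF K0) !orbF.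
by rewrite pnatr_eq0 /= orbb => /eqP.
Qed.

(** A parabola is tangent to the line at infinity: its discriminant vanishes,
    hence [F = 0] and its whole equation is zero. *)
Lemma not_arc_of_parabola : ~ arc_of parabola E.
Proof.
move/conic_image_arc; case=> //.
  by move=> k w _ h; rewrite !mxE exprMn h; ring.
move=> f [g [det0 h]].
have [|] := @discriminant_through_arc
  (f 0 0 ^+ 2) (2 * f 0 0 * f 0 1) (f 0 1 ^+ 2) (2 * f 0 0 * f 0 2 - g 0 0)
  (2 * f 0 1 * f 0 2 - g 0 1) (f 0 2 ^+ 2 - g 0 2).
  move=> t /h /=; rewrite !row3E /pairing ?row3E => /eqP; rewrite -subr_eq0 => /eqP <-.
  by ring.
rewrite (_ : 4 * _ * _ - _ = 0); last by ring.
rewrite mulr0 => /esym/discriminant_eq0 F0 /(_ F0) [/eqP f0 _ /eqP f1 _ _].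
move: f0 f1 det0; rewrite !expf_eq0 /= => /eqP-> /eqP->.
by rewrite !mul0r subrr eqxx.
Qed.

(** A conic through the arc has [F <> 0], since otherwise all its coefficients
    vanish; and its determinant is a nonzero multiple of [F^3]. *)
Lemma not_arc_of_degenerate : ~ arc_of degenerate_conic E.
Proof.
case=> C [M [symM M0 detM eC]] arcC.
have sub : E `<=` C.
  apply: arc_on_sub arcC => w w' ww'; rewrite eC /= => -[w'0 hw'].
  split; first exact: proj_eq_neq0 ww' w'0.
  have [k [_ ->]] := ww'.
  by rewrite linearZ /= -scalemxAl -scalemxAl -scalemxAr mxE [X in _ * X]mxE hw' !mulr0.
(* The same conic in the coordinates of the frame. *)
pose M' := invmx N *m M *m (invmx N)^T.
have [uN _] := aN.
have symM' : M'^T = M' by rewrite /M' !trmx_mul trmxK symM mulmxA.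
have detM' : \det M' = 0 by rewrite /M' !det_mulmx detM mulr0 mul0r.
have M'0 : M' != 0.
  apply: contra_neq M0 => M'0.
  have : N *m M' *m N^T = M.
    rewrite /M' !mulmxA mulmxV // mul1mx -mulmxA -trmx_mul mulmxV // trmx1.
    by rewrite mulmx1.
  by rewrite M'0 mulmx0 mul0mx.
have sym k l : M' l k = M' k l by rewrite -{1}symM' mxE.
have h t : c < t < d -> let w := envelope_pt m K a b t in
     M' 0 0 * w 0 0 ^+ 2 + 2 * M' 0 1 * (w 0 0 * w 0 1) + M' 1 1 * w 0 1 ^+ 2 +
     2 * M' 0 2 * (w 0 0 * w 0 2) + 2 * M' 1 2 * (w 0 1 * w 0 2) +
     M' 2 2 * w 0 2 ^+ 2 = 0.
  move=> ht /=; set w := envelope_pt _ _ _ _ _.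
  have := sub _ (envelope_arc_mem N m K a b ht); rewrite eC => -[_].
  rewrite trmx_mul -/w (_ : _ *m _ *m _ = w *m M' *m w^T); last first.
    by rewrite /M' !mulmxA.
  rewrite mxE sum3E !mulrow3E ![w^T _ _]mxE => <-.
  by rewrite (sym 0 1) (sym 0 2) (sym 1 2); ring.
have [hdisc hF] := discriminant_through_arc h.
have [hA hB hC hD hE] :=
  conic_through_arc (lt0r_neq0 m0) (lt0r_neq0 K0) be0 cd h.
have F0 : M' 2 2 = 0.
  apply: discriminant_eq0; apply/eqP.
  rewrite -/be in hA hB hC hD hE.
  have : M' 2 2 ^+ 3 * (m * K) ^+ 2 * 4 = 0.
    have := detM'; rewrite det3E (sym 0 1) (sym 0 2) (sym 1 2) => hdet.
    have two0 : 2 != 0 :> R by rewrite pnatr_eq0.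
    have hD' : be * M' 0 2 = M' 2 2 * b.
      apply: (mulfI two0).
      by transitivity (be * (2 * M' 0 2)); [ring|rewrite hD; ring].
    have hE' : be * M' 1 2 = M' 2 2 * a.
      apply: (mulfI two0).
      by transitivity (be * (2 * M' 1 2)); [ring|rewrite hE; ring].
    have hB' : be ^+ 2 * M' 0 1 = M' 2 2 * (a * b - 2 * m * K).
      apply: (mulfI two0).
      by transitivity (be ^+ 2 * (2 * M' 0 1)); [ring|rewrite hB; ring].
    transitivity (- (be ^+ 4 * 0)); last by rewrite mulr0 oppr0.
    rewrite -hdet.
    transitivity (- ((be ^+ 2 * M' 0 0) * ((be ^+ 2 * M' 1 1) * M' 2 2 -
       (be * M' 1 2) ^+ 2) - (be ^+ 2 * M' 0 1) * ((be ^+ 2 * M' 0 1) * M' 2 2 -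
       (be * M' 1 2) * (be * M' 0 2)) + (be * M' 0 2) * ((be ^+ 2 * M' 0 1) *
       (be * M' 1 2) - (be ^+ 2 * M' 1 1) * (be * M' 0 2)))).
      by rewrite hA hB' hC hD' hE'; ring.
    by ring.
  move/eqP; rewrite !mulf_eq0 (gt_eqF m0) (gt_eqF K0) pnatr_eq0 /= !orbF !orbb.
  by move=> /eqP ->; rewrite eqxx orbT.
have [A0 B0 C0 D0 E0] := hF F0.
have two0 : 2 != 0 :> R by rewrite pnatr_eq0.
move: B0 D0 E0 => /eqP; rewrite mulf_eq0 (negPf two0) => /eqP B0.
move=> /eqP; rewrite mulf_eq0 (negPf two0) => /eqP D0.
move=> /eqP; rewrite mulf_eq0 (negPf two0) => /eqP E0.
move/eqP: M'0; apply; apply/matrixP => k l; rewrite [RHS]mxE.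
by case: (ord3P k) => ->; case: (ord3P l) => -> //; rewrite sym.
Qed.

Lemma not_finite_point : 0 <= c -> ~ is_finite_point E.
Proof.
move=> c0 [q eE].
have pE t (ht : c < t < d) : proj_eq (envelope_pt m K a b t *m invmx N) (hom q).
  by have := envelope_arc_mem N m K a b ht; rewrite -/E eE.
have [uN _] := aN.
pose t1 := c + (d - c) / 3; pose t2 := c + (d - c) / 2.
have h1 : c < t1 < d by rewrite /t1; move: cd => ?; apply/andP; split; lra.
have h2 : c < t2 < d by rewrite /t2; move: cd => ?; apply/andP; split; lra.
have t10 : 0 < t1 by apply: le_lt_trans c0 _; case/andP: h1.
have t20 : 0 < t2 by apply: le_lt_trans c0 _; case/andP: h2.
have := proj_eq_trans (pE _ h1) (proj_eq_sym (pE _ h2)).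
rewrite proj_eq_mulmx ?unitmx_inv // => /(envelope_pt_inj m0 K0 be0 t10 t20).
by rewrite /t1 /t2; move: cd => ? ?; lra.
Qed.

Lemma arc_on_envelope_arc C : 0 <= c ->
  (forall t, c < t < d -> C (envelope_pt m K a b t *m invmx N)) -> arc_on C E.
Proof.
move=> c0 hC; have [uN _] := aN.
have pos t : c < t < d -> 0 < t by case/andP => /(le_lt_trans c0).
exists c, d, (fun t => envelope_pt m K a b t *m invmx N).
split; [exact: cd|move=> t ht|move=> t t' /pos t0 /pos t'0|reflexivity].
  split; first exact: continuous_envelope_pt.
  split; last exact: hC.
  by rewrite mulmx_unit_eq0 ?unitmx_inv // envelope_pt_neq0.
rewrite proj_eq_mulmx ?unitmx_inv //.
exact: envelope_pt_inj.
Qed.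

Lemma arc_of_affine_image (std : 'rV[R]_3 -> Prop) f g : 0 <= c ->
  f 0 0 * g 0 1 - f 0 1 * g 0 0 != 0 ->
  (forall t, c < t < d -> let w := envelope_pt m K a b t in
      std (row3 (pairing w f) (pairing w g) (w 0 2))) ->
  arc_of (affine_image_of std) E.
Proof.
move=> c0 det0 h; have [uN _] := aN.
exists [set w | w != 0 /\ std (w *m (N *m affmx f g))].
  exists (N *m affmx f g); split=> //.
  by apply: affine_mxM => //; exact: affine_mx_affmx.
apply: arc_on_envelope_arc => // t ht; split.
  by rewrite mulmx_unit_eq0 ?unitmx_inv // envelope_pt_neq0.
by rewrite mulmxA mulmxKV // mulmx_affmx; exact: h.
Qed.

(** Completing the square in the equation
    [(b X + a Y + be W)^2 = 4 m K X Y] of the envelope, first in [X] and then in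
    [Y]; the sign of [be] is the relative sign of the two squares. *)
Lemma envelope_conic t : b != 0 -> let w := envelope_pt m K a b t in
  (b * w 0 0 + (a - 2 * m * K / b) * w 0 1 + be * w 0 2) ^+ 2
  + m * K * be * (2 / b * w 0 1 + w 0 2) ^+ 2 = m * K * be * w 0 2 ^+ 2.
Proof. by move=> b0 /=; rewrite !row3E /be; field. Qed.

Lemma gt0_arc_of_ellipse : 0 <= c -> 0 < be -> arc_of ellipse E.
Proof.
move=> c0 be_gt0.
have b0 : b != 0.
  apply: contraTneq be_gt0 => b0.
  by rewrite /be b0 mulr0 sub0r oppr_gt0 -leNgt ltW // mulr_gt0.
pose r := Num.sqrt (m * K * be).
have r_gt0 : 0 < m * K * be by rewrite !mulr_gt0.
have r2 : r ^+ 2 = m * K * be by rewrite sqr_sqrtr // ltW.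
have r0 : r != 0 by rewrite gt_eqF // sqrtr_gt0.
apply: (@arc_of_affine_image _ (row3 0 (2 / b) 1)
  (r^-1 *: row3 b (a - 2 * m * K / b) be)) => //.
  rewrite !mxE /= (_ : _ - _ = - (2 / r)); last by field; rewrite ?b0 ?r0.
  by rewrite oppr_eq0 mulf_neq0 ?invr_neq0 ?pnatr_eq0.
move=> t ht /=; rewrite !row3E /pairing !mxE /=.
have := envelope_conic t b0; rewrite /= !row3E -r2 => h.
apply: (mulfI (expf_neq0 2 r0)); rewrite -h mulrDr addrC; congr (_ + _).
  by field; rewrite ?b0 ?r0.
by congr (_ * _); ring.
Qed.

Lemma lt0_arc_of_hyperbola : 0 <= c -> be < 0 -> arc_of hyperbola E.
Proof.
move=> c0 be_lt0; have [b0|b0] := eqVneq b 0.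
  (* The asymptotes are [Y = 0] and [4 m K X + 2 m K a W = a^2 Y]. *)
  have mK0 : m * K != 0 by rewrite mulf_neq0 ?gt_eqF.
  have n0 := lt0r_neq0 m0; have k0 := lt0r_neq0 K0.
  apply: (@arc_of_affine_image _ (row3 2 ((1 - a ^+ 2) / (2 * m * K)) a)
    (row3 (- 2) ((1 + a ^+ 2) / (2 * m * K)) (- a))) => //.
    rewrite !row3E (_ : _ - _ = 2 / (m * K)); last by field; rewrite ?k0 ?n0.
    by rewrite mulf_neq0 ?invr_neq0 // pnatr_eq0.
  move=> t ht /=; rewrite !row3E /pairing !row3E b0.
  by field; rewrite ?k0 ?n0.
pose r := Num.sqrt (- (m * K * be)).
have r_gt0 : 0 < - (m * K * be) by rewrite oppr_gt0 pmulr_rlt0 // mulr_gt0.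
have r2 : m * K * be = - r ^+ 2 by rewrite sqr_sqrtr ?opprK // ltW.
have r0 : r != 0 by rewrite gt_eqF // sqrtr_gt0.
apply: (@arc_of_affine_image _ (row3 0 (2 / b) 1)
  (r^-1 *: row3 b (a - 2 * m * K / b) be)) => //.
  rewrite !mxE /= (_ : _ - _ = - (2 / r)); last by field; rewrite ?b0 ?r0.
  by rewrite oppr_eq0 mulf_neq0 ?invr_neq0 ?pnatr_eq0.
move=> t ht /=; rewrite !row3E /pairing !mxE /=.
have := envelope_conic t b0; rewrite /= !row3E r2 => h.
apply: (mulfI (expf_neq0 2 r0)); apply: oppr_inj.
rewrite -mulNr -[RHS]mulNr -h mulrBr addrC; congr (_ + _).
  by field; rewrite ?b0 ?r0.
by congr (_ * _); ring.
Qed.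

End Discriminant.

(** An arc is parametrized injectively, so it is never reduced to one point. *)
Lemma arc_two_points (C E : set 'rV[R]_3) w :
  arc_on C E -> E `<=` [set w' | proj_eq w' w] -> False.
Proof.
move=> [c [d [g [cd _ inj ->]]]] sub.
pose t1 := c + (d - c) / 3; pose t2 := c + (d - c) / 2.
have h1 : c < t1 < d by rewrite /t1; apply/andP; split; lra.
have h2 : c < t2 < d by rewrite /t2; apply/andP; split; lra.
have : t1 = t2.
  apply: inj => //; apply: (@proj_eq_trans _ w).
    by apply: sub; exists t1 => //; exact: proj_eq_refl.
  by apply/proj_eq_sym/sub; exists t2 => //; exact: proj_eq_refl.
by rewrite /t1 /t2; lra.
Qed.

End Types.

(** * Convex polygons with parallel opposite sides *)

Section Polygon.
Context {R : realType} (n : nat) (P : nat -> 'rV[R]_2) (mu : nat -> R).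
Hypothesis hP : cppos n P mu.
Implicit Types (i j k l : nat) (q X Y : 'rV[R]_2) (s : R).

(** Proportional to the signed distance to the supporting line of the side [k],
    positive inside the polygon. *)
Definition height k q : R := det2 (edge P k) (q - P k).

Definition width k : R := height k (P (k + n)%N).

Lemma height_comb k s X Y :
  height k (X + s *: (Y - X)) = (1 - s) * height k X + s * height k Y.
Proof. by rewrite /height /det2 !mxE; ring. Qed.

Lemma height_along k l s :
  height k (P l + s *: edge P l) =
  height k (P l) + s * det2 (edge P k) (edge P l).
Proof. by rewrite /height /det2 !mxE; ring. Qed.

Lemma det2vv (u : 'rV[R]_2) : det2 u u = 0.
Proof. by rewrite /det2; ring. Qed.

Lemma det2_eq0 (e w : 'rV[R]_2) :
  e != 0 -> det2 e w = 0 -> exists s, w = s *: e.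
Proof.
move=> e0 /eqP; rewrite subr_eq0 => /eqP h.
have [z0|n0] := eqVneq (e 0 0) 0; last first.
  exists (w 0 0 / e 0 0); apply: row2P; rewrite !mxE; first by rewrite divfK.
  by rewrite mulrAC [X in X / _]mulrC -h mulrC mulKf.
have n1 : e 0 1 != 0.
  by apply: contra_neq e0 => z1; apply: row2P; rewrite mxE.
exists (w 0 1 / e 0 1); apply: row2P; rewrite !mxE; last by rewrite divfK.
move: h; rewrite z0 mul0r mulr0 => /esym/eqP.
by rewrite mulf_eq0 (negPf n1) /= => /eqP.
Qed.

Lemma height_own_vertex k : height k (P k) = 0.
Proof. by rewrite /height /det2 !mxE; ring. Qed.

Lemma height_own_side k s : height k (P k + s *: edge P k) = 0.
Proof. by rewrite height_along height_own_vertex det2vv mulr0 addr0. Qed.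

Lemma next_vertex k : P k.+1 = P k + 1 *: edge P k.
Proof. by rewrite scale1r /edge addrC subrK. Qed.

Lemma cppos_n_gt1 : (1 < n)%N.
Proof. by case: hP. Qed.

Lemma mu_gt0 k : 0 < mu k.
Proof. by case: hP => _ _ _ _ /(_ k) []. Qed.

Lemma edge_opp k : edge P (k + n) = - mu k *: edge P k.
Proof. by case: hP => _ _ _ _ /(_ k) []. Qed.

Lemma edge_neq0 k : edge P k != 0.
Proof.
case: hP => _ _ _ /(_ k) h _; apply: contra_neq h => ->.
by rewrite /det2 !mxE; ring.
Qed.

Lemma vertex_mod k l : k = l %[mod n.*2] -> P k = P l.
Proof.
have per r m : P (r + m * n.*2)%N = P r.
  elim: m => [|m IH]; first by rewrite mul0n addn0.
  by case: hP => _ hper _ _ _; rewrite mulSn addnCA addnC hper.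
by rewrite {2}(divn_eq k n.*2) {2}(divn_eq l n.*2) ![(_ * _ + _)%N]addnC !per => ->.
Qed.

Lemma edge_mod k l : k = l %[mod n.*2] -> edge P k = edge P l.
Proof.
move=> kl; rewrite /edge (vertex_mod kl) (@vertex_mod k.+1 l.+1) //.
by apply/eqP; rewrite -addn1 -[l.+1]addn1 eqn_modDr; apply/eqP.
Qed.

Lemma height_vertex_gt0 k l : (l != k %[mod n.*2])%N ->
  (l != k.+1 %[mod n.*2])%N -> 0 < height k (P l).
Proof. by case: hP => _ _ + _ _; exact. Qed.

Lemma height_vertex_ge0 k l : 0 <= height k (P l).
Proof.
have [e|lk] := eqVneq (l %% n.*2)%N (k %% n.*2)%N.
  by rewrite (vertex_mod e) height_own_vertex.
have [e|lk1] := eqVneq (l %% n.*2)%N (k.+1 %% n.*2)%N.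
  by rewrite (vertex_mod e) next_vertex height_own_side.
exact/ltW/height_vertex_gt0.
Qed.

Lemma modD_neq k d : (0 < d < n.*2)%N -> (k + d != k %[mod n.*2])%N.
Proof.
move=> /andP[d0 dn]; rewrite -[X in _ != (X %% _)%N]addn0 eqn_modDl.
by rewrite mod0n modn_small // -lt0n.
Qed.

Lemma width_gt0 k : 0 < width k.
Proof.
have n1 := cppos_n_gt1; apply: height_vertex_gt0.
  by apply: modD_neq; lia.
by rewrite (_ : (k + n)%N = (k.+1 + n.-1)%N); [apply: modD_neq; lia|lia].
Qed.

Lemma side_height_ge0 k l q : side P l q -> 0 <= height k q.
Proof.
move=> [s /andP[s0 s1] ->]; rewrite /edge height_comb.
by rewrite addr_ge0 // mulr_ge0 ?height_vertex_ge0 ?subr_ge0.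
Qed.

Lemma boundary_height_ge0 k q : polygon_boundary P q -> 0 <= height k q.
Proof. by case=> l _; exact: side_height_ge0. Qed.

Lemma open_side_side l q : open_side P l q -> side P l q.
Proof. by move=> [s /andP[s0 s1] ->]; exists s; rewrite // !ltW. Qed.

Lemma open_side_boundary l q : open_side P l q -> polygon_boundary P q.
Proof. by move=> /open_side_side h; exists l. Qed.

(** At most one endpoint of the side [l] is on the supporting line of another
    side [k], and the heights of both are nonnegative. *)
Lemma open_side_height_gt0 k l q : (l != k %[mod n.*2])%N ->
  open_side P l q -> 0 < height k q.
Proof.
move=> lk [s /andP[s0 s1] ->]; rewrite /edge height_comb.
have s1' : 0 < 1 - s by rewrite subr_gt0.
have [e|lk1] := eqVneq (l %% n.*2)%N (k.+1 %% n.*2)%N; last first.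
  apply: ltr_wpDr; first by rewrite mulr_ge0 ?height_vertex_ge0 ?ltW.
  by rewrite mulr_gt0 ?height_vertex_gt0.
apply: ltr_wpDl; first by rewrite mulr_ge0 ?height_vertex_ge0 ?ltW.
rewrite mulr_gt0 // (@vertex_mod _ (k.+1 + 1)%N); last first.
  by apply/eqP; rewrite -[l.+1]addn1 eqn_modDr; apply/eqP.
have n1 := cppos_n_gt1.
apply: height_vertex_gt0; last by apply: modD_neq; lia.
by rewrite (_ : (k.+1 + 1)%N = (k + 2)%N); [apply: modD_neq; lia|lia].
Qed.

Lemma nonparallel_mod i j : det2 (edge P i) (edge P j) != 0 ->
  (i != j %[mod n.*2])%N.
Proof. by apply: contra_neq => e; rewrite (edge_mod e) det2vv. Qed.

(** Along the line, the height over the side [i] is negative behind [X] and the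
    height over the side [j] is negative beyond [Y], which excludes boundary
    points; between [X] and [Y] all heights are positive. *)
Lemma line_boundary i j X Y : det2 (edge P i) (edge P j) != 0 ->
  open_side P i X -> open_side P j Y ->
  line X Y `&` polygon_boundary P = [set X; Y].
Proof.
move=> dij oX oY; have ij := nonparallel_mod dij.
have hX : height i X = 0 by case: oX => s _ ->; rewrite height_own_side.
have hY : height j Y = 0 by case: oY => s _ ->; rewrite height_own_side.
have iY : 0 < height i Y by apply: open_side_height_gt0 oY; rewrite eq_sym.
have jX : 0 < height j X by exact: open_side_height_gt0 oX.
apply/seteqP; split=> q /=; last first.
  case=> ->; split.
  - by exists 0; rewrite scale0r addr0.
  - exact: open_side_boundary oX.
  - by exists 1; rewrite scale1r addrC subrK.
  - exact: open_side_boundary oY.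
move=> [[s ->] bq].
have := boundary_height_ge0 i bq; rewrite height_comb hX mulr0 add0r.
rewrite pmulr_lge0 // le_eqVlt => /orP[/eqP <-|s0].
  by left; rewrite scale0r addr0.
have := boundary_height_ge0 j bq; rewrite height_comb hY mulr0 addr0.
rewrite pmulr_lge0 // le_eqVlt eq_sym subr_eq0 => /orP[/eqP <-|s1].
  by right; rewrite scale1r addrC subrK.
(* A point strictly between [X] and [Y] is off every supporting line. *)
case: bq => l _ bq; exfalso.
have : height l (X + s *: (Y - X)) = 0.
  by case: bq => r _ ->; rewrite height_own_side.
rewrite height_comb => /eqP; apply/negP; rewrite gt_eqF //.
have [e|il] := eqVneq (i %% n.*2)%N (l %% n.*2)%N; last first.
  apply: ltr_wpDr; last by rewrite mulr_gt0 // (open_side_height_gt0 il).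
  by rewrite mulr_ge0 ?(side_height_ge0 l (open_side_side oY)) ?ltW.
apply: ltr_wpDl.
  by rewrite mulr_ge0 ?(side_height_ge0 l (open_side_side oX)) ?ltW.
by rewrite mulr_gt0 // (open_side_height_gt0 _ oY) // -e eq_sym.
Qed.

Lemma interior_height_gt0 k (p : 'rV[R]_2) : (region P)° p -> 0 < height k p.
Proof.
move=> hp; have := edge_neq0 k; set e := edge P k => e0.
(* Moving [p] by [r *: w] lowers the height by [r * (e_0^2 + e_1^2)]. *)
pose w : 'rV[R]_2 := \row_l [:: e 0 1; - e 0 0]`_l.
have D0 : 0 < e 0 0 ^+ 2 + e 0 1 ^+ 2.
  rewrite lt_neqAle addr_ge0 ?sqr_ge0 // andbT eq_sym paddr_eq0 ?sqr_ge0 //.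
  rewrite !expf_eq0 /=; apply: contra e0 => /andP[/eqP a /eqP b].
  by apply/eqP/row2P; rewrite ?a ?b mxE.
have cont : (fun r : R => p + r *: w) @ (0 : R) --> p.
  rewrite -[X in _ --> X]addr0 -(scale0r w).
  by apply: cvgD; [exact: cvg_cst|apply: cvgZ; [exact: cvg_id|exact: cvg_cst]].
have /nbhs_ballP[r /= r0 hr] := cont _ hp.
have : region P (p + (r / 2) *: w).
  apply: (hr (r / 2)); rewrite /ball /= sub0r normrN ger0_norm.
    by rewrite ltr_pdivrMr // ltr_pMr // ltr1n.
  by rewrite divr_ge0 // ltW.
move=> /(_ k); rewrite -/e (_ : det2 _ _ =
  height k p - r / 2 * (e 0 0 ^+ 2 + e 0 1 ^+ 2)); last first.
  by rewrite /height -/e /det2 !mxE /=; ring.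
by rewrite subr_ge0; apply: lt_le_trans; rewrite mulr_gt0 // divr_gt0.
Qed.

(** On an open side the boundary involution is single-valued: such a point is on
    no other side. *)
Lemma sigma_open_side i X X' : open_side P i X -> sigma P n X X' ->
  exists s, [/\ 0 < s < 1, X = P i + s *: edge P i &
    X' = P (i + n)%N + s *: edge P (i + n)%N].
Proof.
move=> oX [k [s [s01 eX ->]]].
have ki : k = i %[mod n.*2].
  apply/eqP; apply/negPn/negP; rewrite eq_sym => ik.
  have := open_side_height_gt0 ik oX.
  by rewrite eX height_own_side ltxx.
have kin : (k + n = i + n %[mod n.*2])%N.
  by apply/eqP; rewrite eqn_modDr; apply/eqP.
rewrite (vertex_mod ki) (edge_mod ki) in eX.
exists s; rewrite (vertex_mod kin) (edge_mod kin); split=> //.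
case: oX => s' hs'; rewrite eX => /addrI /eqP.
rewrite -subr_eq0 -scalerBl scaler_eq0 (negPf (edge_neq0 i)) orbF subr_eq0.
by move=> /eqP ->.
Qed.

Lemma open_side_sigma i s : 0 < s < 1 ->
  sigma P n (P i + s *: edge P i) (P (i + n)%N + s *: edge P (i + n)%N).
Proof. by move=> /andP[s0 s1]; exists i, s; rewrite !ltW. Qed.

Definition coord k q : R := height k q / width k.

Definition coord_form k : 'rV[R]_3 :=
  (width k)^-1 *: row3 (- edge P k 0 1) (edge P k 0 0)
    (edge P k 0 1 * P k 0 0 - edge P k 0 0 * P k 0 1).

Lemma pairing_coord k q : pairing (hom q) (coord_form k) = coord k q.
Proof. by rewrite /pairing /hom !mxE /= /coord /height /det2 !mxE; ring. Qed.

Lemma coord_affine k : affine_fun (coord k).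
Proof.
exists (coord_form k 0 0), (coord_form k 0 1), (coord_form k 0 2) => q.
by rewrite -pairing_coord /pairing /hom !row3E; ring.
Qed.

Lemma side_lineE k : side_line P k = [set q | height k q = 0].
Proof.
apply/seteqP; split=> q /=; first by case=> s ->; exact: height_own_side.
move=> h; have [s es] := det2_eq0 (edge_neq0 k) h.
by exists s; rewrite -es subrKC.
Qed.

Lemma height_opp k q : height (k + n) q = mu k * (width k - height k q).
Proof. by rewrite /width /height edge_opp /det2 !mxE; ring. Qed.

Lemma coord_side_line k : side_line P k = [set q | coord k q = 0].
Proof.
rewrite side_lineE; apply/seteqP; split=> q /=; rewrite /coord.
  by move=> ->; rewrite mul0r.
by move/eqP; rewrite mulf_eq0 invr_eq0 (gt_eqF (width_gt0 k)) orbF => /eqP.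
Qed.

Lemma coord_opp_side_line k : side_line P (k + n)%N = [set q | coord k q = 1].
Proof.
have w0 := width_gt0 k; rewrite side_lineE; apply/seteqP; split=> q /=.
  rewrite height_opp => /eqP; rewrite mulf_eq0 (gt_eqF (mu_gt0 k)) /=.
  by rewrite subr_eq0 /coord => /eqP <-; rewrite divff ?gt_eqF.
rewrite /coord height_opp => h; rewrite -[height k q](divfK (lt0r_neq0 w0)) h.
by rewrite mul1r subrr mulr0.
Qed.

(** The two level sets give the values of [f] at [P k] and [P (k + n)] and make
    its linear part vanish on [edge P k]; this is a full set of conditions,
    because [width k <> 0]. *)
Lemma coord_unique k (f : 'rV[R]_2 -> R) : affine_fun f ->
  side_line P k = [set q | f q = 0] ->
  side_line P (k + n)%N = [set q | f q = 1] -> f = coord k.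
Proof.
move=> [a [b [c hf]]] h0 h1; apply/funext => q.
have e0 : f (P k) = 0.
  by rewrite -[_ = 0]/([set q | f q = 0] _) -h0; exists 0; rewrite scale0r addr0.
have e1 : f (P k + 1 *: edge P k) = 0.
  by rewrite -[_ = 0]/([set q | f q = 0] _) -h0; exists 1.
have e2 : f (P (k + n)%N) = 1.
  by rewrite -[_ = 1]/([set q | f q = 1] _) -h1; exists 0; rewrite scale0r addr0.
have w0 := lt0r_neq0 (width_gt0 k); apply: (mulIf w0).
rewrite /coord divfK //; move: e0 e1 e2; rewrite !hf /width /height /det2.
move: (edge P k) (P k) (P (k + n)%N) => e x y; rewrite !mxE => e0 e1 e2.
have ab : a * e 0 0 + b * e 0 1 = 0 by rewrite -e1 -[LHS](addr0) -e0; ring.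
have cE : c = - (a * x 0 0 + b * x 0 1).
  by apply/eqP; rewrite -addr_eq0 addrC e0.
have dE : a * (y 0 0 - x 0 0) + b * (y 0 1 - x 0 1) = 1.
  by rewrite -e2 cE; ring.
rewrite cE; apply/eqP; rewrite -subr_eq0 -[X in _ - X]mul1r -dE; apply/eqP.
transitivity ((a * e 0 0 + b * e 0 1) *
  ((y 0 1 - x 0 1) * (q 0 0 - x 0 0) - (q 0 1 - x 0 1) * (y 0 0 - x 0 0))).
  by ring.
by rewrite ab mul0r.
Qed.

Lemma coord_interior k (p : 'rV[R]_2) : (region P)° p -> 0 < coord k p < 1.
Proof.
move=> hp; have w0 := width_gt0 k.
apply/andP; split; first by
  apply: divr_gt0 => //; exact: interior_height_gt0.
rewrite /coord ltr_pdivrMr // mul1r; have := interior_height_gt0 (k + n) hp.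
by rewrite height_opp pmulr_rgt0 ?mu_gt0 // subr_gt0.
Qed.

Lemma coord_open_side_gt0 k l q : (l != k %[mod n.*2])%N ->
  open_side P l q -> 0 < coord k q.
Proof.
move=> lk oq; apply: divr_gt0; last exact: width_gt0.
exact: open_side_height_gt0 oq.
Qed.

Lemma coord_opp_side_lt1 k l q : (l != k %[mod n.*2])%N ->
  open_side P (l + n)%N q -> coord k q < 1.
Proof.
move=> lk oq; rewrite /coord ltr_pdivrMr ?width_gt0 // mul1r.
have lkn : (l + n != k + n %[mod n.*2])%N by rewrite eqn_modDr.
have := open_side_height_gt0 lkn oq.
by rewrite height_opp pmulr_rgt0 ?mu_gt0 // subr_gt0.
Qed.

Lemma coord_along k l s : coord k (P l + s *: edge P l) =
  coord k (P l) + s * (det2 (edge P k) (edge P l) / width k).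
Proof. by rewrite /coord height_along mulrDl mulrA. Qed.

Lemma coord_own_side k s : coord k (P k + s *: edge P k) = 0.
Proof. by rewrite /coord height_own_side mul0r. Qed.

Lemma coord_opp_side k s :
  coord k (P (k + n)%N + s *: edge P (k + n)%N) = 1.
Proof.
rewrite coord_along edge_opp (_ : det2 _ _ = 0).
  by rewrite mul0r mulr0 addr0 /coord -/(width k) divff // gt_eqF ?width_gt0.
by rewrite /det2 !mxE; ring.
Qed.

(** The number [A] of the frame.  The sum [coord j X' + mu i * coord j X] has the
    same value for every point [X] of the side line [i] and its image [X'], so it
    may be computed at the vertex [P i] instead of at the intersection point of
    the two side lines. *)
Definition shift i j : R :=
  coord j (P (i + n)%N) + mu i * coord j (P i) - 1.

Lemma coord_sigma i j s :
  coord j (P (i + n)%N + s *: edge P (i + n)%N) =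
  1 + shift i j - mu i * coord j (P i + s *: edge P i).
Proof.
rewrite !coord_along edge_opp /shift (_ : det2 _ (_ *: _) =
  - mu i * det2 (edge P j) (edge P i)); last by rewrite /det2 !mxE; ring.
by ring.
Qed.

End Polygon.

(** * Lines in a plane with affine coordinates *)

Section AffineFrame.
Context {R : realType}.
Implicit Types (N : 'M[R]_3) (w : 'rV[R]_3) (q : 'rV[R]_2).

Lemma hline_frame N w q :
  hline (w *m N^T) q <-> pairing (hom q *m N) w = 0.
Proof. by rewrite hlineE pairing_mulmx. Qed.

Lemma frame_point N x y : affine_mx N -> exists q, hom q *m N = row3 x y 1.
Proof.
move=> aN; have [uN _] := aN; have [_ cV] := affine_mxV aN.
pose w := row3 x y 1 *m invmx N; exists (\row_k w 0 (widen_ord (leqnSn 2) k)).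
have <- : w *m N = row3 x y 1 by rewrite mulmxKV.
congr (_ *m N); apply: row3P; rewrite !row3E.
- by rewrite mxE; congr (w _ _); apply/val_inj.
- by rewrite mxE; congr (w _ _); apply/val_inj.
- by rewrite mulrow3E !row3E !cV /= !mulr0 !add0r mulr1.
Qed.

Lemma hom_inj N q q' : N \in unitmx -> hom q *m N = hom q' *m N -> q = q'.
Proof.
move=> uN e; have : hom q = hom q' by rewrite -[LHS](mulmxK uN) e mulmxK.
move=> /rowP e'; apply: row2P; first by have := e' 0; rewrite !row3E.
by have := e' 1; rewrite !row3E.
Qed.

Lemma is_line_hline N (l : set 'rV[R]_2) w q1 q2 : affine_mx N -> is_line l ->
  l q1 -> l q2 -> q1 != q2 -> (w 0 0 != 0) || (w 0 1 != 0) ->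
  pairing (hom q1 *m N) w = 0 -> pairing (hom q2 *m N) w = 0 ->
  l = hline (w *m N^T).
Proof.
move=> aN [x [y [xy ->]]] [s1 e1] [s2 e2] q12 w0 h1 h2.
have [uN _] := aN; have [_ cV] := affine_mxV aN.
have w0' : ((w *m N^T) 0 0 != 0) || ((w *m N^T) 0 1 != 0).
  apply: contraT; rewrite negb_or !negbK => /andP[/eqP z0 /eqP z1].
  have /rowP ew : (w *m N^T) *m (invmx N)^T = w.
    by rewrite -mulmxA -trmx_mul mulVmx // trmx1 mulmx1.
  move: w0; have e k : w 0 k = (w *m N^T) 0 2 * (k == 2)%:R.
    by rewrite -(ew k) mulrow3E z0 z1 !mul0r !add0r [(invmx N)^T _ _]mxE cV.
  by rewrite !e /= mulr0 eqxx.
rewrite -(line_hline w0' q12); [|exact/hline_frame|exact/hline_frame].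
have s12 : s2 - s1 != 0.
  by apply: contra_neq q12 => /eqP; rewrite subr_eq0 => /eqP es; rewrite e1 e2 es.
apply/seteqP; split=> _ [s ->].
  exists ((s - s1) / (s2 - s1)); rewrite e1 e2; apply: row2P; rewrite !mxE;
    by field.
exists (s1 + s * (s2 - s1)); rewrite e1 e2; apply: row2P; rewrite !mxE; ring.
Qed.

Lemma line_is_line (x y : 'rV[R]_2) : x != y -> is_line (line x y).
Proof. by move=> xy; exists x, y. Qed.

Lemma line_left (x y : 'rV[R]_2) : line x y x.
Proof. by exists 0; rewrite scale0r addr0. Qed.

Lemma line_right (x y : 'rV[R]_2) : line x y y.
Proof. by exists 1; rewrite scale1r subrKC. Qed.

Lemma lineC (x y : 'rV[R]_2) : line x y = line y x.
Proof.
by apply/seteqP; split=> _ [s ->]; exists (1 - s); apply: row2P; rewrite !mxE; ring.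
Qed.

Lemma line_det2 (l : set 'rV[R]_2) p q r :
  is_line l -> l p -> l q -> l r -> det2 (q - p) (r - p) = 0.
Proof.
by move=> [x [y [_ ->]]] [s1 ->] [s2 ->] [s3 ->]; rewrite /det2 !mxE; ring.
Qed.

Lemma set2_eq (T : Type) (x y X Y : T) : [set x; y] = [set X; Y] -> x <> y ->
  (x = X /\ y = Y) \/ (x = Y /\ y = X).
Proof.
move=> e xy.
have [ex|ex] : [set X; Y] x by rewrite -e; left.
  have [ey|ey] : [set X; Y] y by rewrite -e; right.
    by case: xy; rewrite ex ey.
  by left.
have [ey|ey] : [set X; Y] y by rewrite -e; right.
  by right.
by case: xy; rewrite ex ey.
Qed.

Lemma between_param (x d y : R) : d != 0 ->
  (exists2 s, 0 < s < 1 & x + s * d = y) <->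
  Num.min x (x + d) < y < Num.max x (x + d).
Proof.
move=> d0; split=> [[s /andP[s0 s1] <-]|].
  have [dlt|dgt|/eqP] := ltgtP d 0; last by rewrite (negPf d0).
    rewrite minEle maxEle lerDl leNgt dlt /=.
    by apply/andP; split; nra.
  rewrite minEle maxEle lerDl (ltW dgt) /=.
  by apply/andP; split; nra.
move=> h; exists ((y - x) / d); last by rewrite divfK // subrKC.
move: h; have [dlt|dgt|/eqP] := ltgtP d 0; last by rewrite (negPf d0).
  rewrite minEle maxEle lerDl leNgt dlt /= => /andP[h1 h2].
  by rewrite ltr_ndivlMr // ltr_ndivrMr // mul0r mul1r; apply/andP; split; lra.
rewrite minEle maxEle lerDl (ltW dgt) /= => /andP[h1 h2].
by rewrite ltr_pdivlMr // ltr_pdivrMr // mul0r mul1r; apply/andP; split; lra.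
Qed.

(** The condition [k / t < hi'] is a lower bound for [t], and [lo' < k / t] is an
    upper bound for [t] if [lo' > 0] and void otherwise. *)
Lemma hyperbola_itv (k lo hi lo' hi' : R) : 0 < k ->
  (exists2 t, 0 < t & lo < t < hi /\ lo' * t < k < hi' * t) ->
  exists c d, [/\ 0 <= c, c < d & forall t,
    (0 < t /\ (lo < t < hi /\ lo' * t < k < hi' * t)) <-> c < t < d].
Proof.
move=> k0 [t0 t00 [/andP[h1 h2] /andP[h3 h4]]].
have hi'0 : 0 < hi' by rewrite -(pmulr_lgt0 _ t00); exact: lt_trans h4.
pose c := Num.max 0 (Num.max lo (k / hi')).
pose d := if lo' <= 0 then hi else Num.min hi (k / lo').
have E t : (0 < t /\ (lo < t < hi /\ lo' * t < k < hi' * t)) <-> c < t < d.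
  rewrite /c !gt_max ltr_pdivrMr // [t * hi']mulrC /d.
  case: (leP lo' 0) => lo'0.
    split=> [[-> [/andP[-> ->] /andP[_ ->]]] //|].
    move=> /andP[/and3P[t1 -> ->] ->]; do 2!split=> //.
    by rewrite andbT (le_lt_trans _ k0) // mulr_le0_ge0 // ltW.
  rewrite lt_min ltr_pdivlMr // [t * lo']mulrC.
  split=> [[-> [/andP[-> ->] /andP[-> ->]]] //|].
  by move=> /andP[/and3P[-> -> ->] /andP[-> ->]].
exists c, d; split=> //; first by rewrite /c le_max lexx.
have /E/andP[ct td] : 0 < t0 /\ (lo < t0 < hi /\ lo' * t0 < k < hi' * t0).
  by rewrite h1 h2 h3 h4.
exact: lt_trans ct td.
Qed.

End AffineFrame.

(** * Derivatives *)

Section Derivatives.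
Context {R : realType}.
Implicit Types (f g : R -> R) (s c d : R).

Lemma is_derive_funM f g s df dg : is_derive s 1 f df -> is_derive s 1 g dg ->
  is_derive s 1 (fun t => f t * g t) (df * g s + f s * dg).
Proof.
move=> hf hg; have := is_deriveM hf hg.
by rewrite /GRing.scale /= addrC [g s * _]mulrC.
Qed.

Lemma is_derive_funD f g s df dg : is_derive s 1 f df -> is_derive s 1 g dg ->
  is_derive s 1 (fun t => f t + g t) (df + dg).
Proof. by move=> hf hg; exact: is_deriveD hf hg. Qed.

Lemma is_derive_const (k : R) s : is_derive s 1 (fun _ : R => k) 0.
Proof. exact: is_derive_cst. Qed.

Lemma is_derive_scale (k : R) f s df : is_derive s 1 f df ->
  is_derive s 1 (fun t => k * f t) (k * df).
Proof.
by move=> hf; have := is_derive_funM (is_derive_const k s) hf; rewrite mul0r add0r.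
Qed.

Lemma is_derive_div f g s df dg : is_derive s 1 f df -> is_derive s 1 g dg ->
  g s != 0 ->
  is_derive s 1 (fun t => f t / g t) ((df * g s - f s * dg) / g s ^+ 2).
Proof.
move=> hf hg g0.
have hV : is_derive s 1 (fun t => (g t)^-1) (- (g s) ^- 2 *: dg).
  have gd : derivable g s 1 by case: hg.
  by apply: DeriveDef; [exact: derivableV|rewrite deriveV //; case: hg => _ ->].
have := is_derive_funM hf hV.
rewrite (_ : _ + _ = (df * g s - f s * dg) / g s ^+ 2) //.
by rewrite /GRing.scale /=; field.
Qed.

Lemma is_derive_itv0 f c d s df : c < s < d ->
  (forall t, c < t < d -> f t = 0) -> is_derive s 1 f df -> df = 0.
Proof.
move=> sI f0 hf.
have h0 : is_derive s 1 (fun _ : R => 0 : R) df.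
  apply: near_eq_is_derive hf; have sI' : s \in `]c, d[ by rewrite in_itv.
  have := near_in_itvoo sI'; apply: filterS => t; rewrite in_itv /= => tI.
  exact: f0.
by have [_ <-] := h0; have [_ ->] := is_derive_const 0 s.
Qed.

Lemma is_derive_mulmx (lam : R -> 'rV[R]_3) (M : 'M[R]_3) s k :
  derivable lam s 1 ->
  is_derive s 1 (fun t => (lam t *m M) 0 k) ((derive1 lam s *m M) 0 k).
Proof.
move=> dl.
have comp l : is_derive s 1 (fun t => lam t 0 l) (derive1 lam s 0 l).
  apply: DeriveDef; first by have := (derivable_mxP _ _ _).1 dl 0 l.
  by rewrite derive1E derive_mx // mxE.
have := is_derive_funD (is_derive_funD (is_derive_scale (M 0 k) (comp 0))
  (is_derive_scale (M 1 k) (comp 1))) (is_derive_scale (M 2 k) (comp 2)).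
rewrite (_ : (fun t => _) = fun t => (lam t *m M) 0 k); last first.
  by apply/funext => t; rewrite mulrow3E; ring.
by rewrite (_ : _ + _ + _ = (derive1 lam s *m M) 0 k) // mulrow3E; ring.
Qed.

Lemma is_derive_quadratic (w0 w1 w2 : 'rV[R]_3) s :
  is_derive s 1 (fun t : R => t *: (t *: w2) + t *: w1 + w0)
    (s *: (2 *: w2) + w1).
Proof.
set f := fun t : R => _.
have comp l : is_derive s 1 (fun t => f t 0 l) ((s *: (2 *: w2) + w1) 0 l).
  have hid := is_derive_id s (1 : R).
  have := is_derive_funD (is_derive_funD
    (is_derive_scale (w2 0 l) (is_derive_funM hid hid))
    (is_derive_scale (w1 0 l) hid)) (is_derive_const (w0 0 l) s).
  rewrite (_ : (fun t => _) = fun t => f t 0 l); last first.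
    by apply/funext => t; rewrite /f !mxE; ring.
  by rewrite (_ : _ + 0 = (s *: (2 *: w2) + w1) 0 l) // !mxE; ring.
have df : derivable f s 1.
  by apply/derivable_mxP => k l; rewrite ord1; case: (comp l).
apply: DeriveDef => //; rewrite derive_mx //; apply/rowP => l; rewrite mxE.
by case: (comp l).
Qed.

End Derivatives.

(** * The frame of two nonparallel sides *)

Section Frame.
Context {R : realType} (n : nat) (P : nat -> 'rV[R]_2) (mu : nat -> R).
Context (i j : nat).
Hypotheses (hP : cppos n P mu) (dij : det2 (edge P i) (edge P j) != 0).
Implicit Types (x y : R) (q r s : 'rV[R]_2) (F : @frame R).

Local Notation crd := (coord n P).

Lemma nonparallel_sym : det2 (edge P j) (edge P i) != 0.
Proof. by rewrite -oppr_eq0 (_ : - _ = det2 (edge P i) (edge P j)) // /det2; ring. Qed.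

Definition frame_at x y : 'M[R]_3 :=
  affmx (coord_form n P j - row3 0 0 x) (coord_form n P i - row3 0 0 y).

Lemma hom_frame_at x y q :
  hom q *m frame_at x y = row3 (crd j q - x) (crd i q - y) 1.
Proof.
rewrite mulmx_affmx /hom row3E -/(hom q) -!(pairing_coord n P).
by congr row3; rewrite /pairing /hom !mxE /=; ring.
Qed.

Lemma frame_at_affine x y : affine_mx (frame_at x y).
Proof.
apply: affine_mx_affmx.
have wi := lt0r_neq0 (width_gt0 hP i); have wj := lt0r_neq0 (width_gt0 hP j).
rewrite /coord_form; move: (edge P i) (edge P j) dij => ei ej d0.
rewrite !mxE /= !subr0 (_ : _ - _ =
  - (det2 ei ej) / (width n P i * width n P j)).
  by rewrite mulf_neq0 ?oppr_eq0 // invr_neq0 // mulf_neq0.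
by rewrite /det2; field; rewrite wi wj.
Qed.

Lemma coord_det q r s :
  (crd j q - crd j s) * (crd i r - crd i s) -
  (crd i q - crd i s) * (crd j r - crd j s) =
  - det2 (edge P i) (edge P j) / (width n P i * width n P j) *
  det2 (q - s) (r - s).
Proof.
have wi := lt0r_neq0 (width_gt0 hP i); have wj := lt0r_neq0 (width_gt0 hP j).
rewrite /coord /height; move: wi wj; move: (width n P i) (width n P j) => wi wj.
move: (edge P i) (edge P j) => ei ej ni nj.
by rewrite /det2 !mxE; field; rewrite ni nj.
Qed.

Lemma coord_inj q r : crd j q = crd j r -> crd i q = crd i r -> q = r.
Proof.
move=> ej ei; have [uN _] := frame_at_affine 0 0.
by apply: (hom_inj uN); rewrite !hom_frame_at ej ei.
Qed.

Lemma coord_surj x y : exists q, crd j q = x /\ crd i q = y.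
Proof.
have [q] := frame_point x y (frame_at_affine 0 0).
rewrite hom_frame_at !subr0 => /rowP e; exists q.
by have := e 0; have := e 1; rewrite !row3E.
Qed.

Lemma is_frameE F : is_frame P n i j F ->
  [/\ fx F = crd j, fy F = crd i, crd j (fS F) = 0 /\ crd i (fS F) = 0,
      crd j (fSstar F) = 1 /\ crd i (fSstar F) = 1 &
      fA F = shift n P mu i j /\ fB F = shift n P mu j i].
Proof.
move=> [[ax x0 x1] [ay y0 y1] [eS eS']].
rewrite (coord_unique hP ax x0 x1) (coord_unique hP ay y0 y1) => hA hB.
have [Si Sj] : (side_line P i `&` side_line P j) (fS F) by rewrite eS.
have [S'i S'j] : (side_line P (i + n)%N `&` side_line P (j + n)%N) (fSstar F).
  by rewrite eS'.
rewrite (coord_side_line hP) /= in Si; rewrite (coord_side_line hP) /= in Sj.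
rewrite (coord_opp_side_line hP) /= in S'i.
rewrite (coord_opp_side_line hP) /= in S'j.
do 2!split=> //.
  have [q [[s [es ->]] e _]] := hA; move: e.
  by rewrite (coord_sigma hP i j) -es Sj mulr0 subr0 => /addrI.
have [q [[s [es ->]] _ e]] := hB; move: e.
by rewrite (coord_sigma hP j i) -es Si mulr0 subr0 => /addrI.
Qed.

Lemma is_frame_exists : exists F, is_frame P n i j F.
Proof.
have [S [Sj Si]] := coord_surj 0 0; have [S' [S'j S'i]] := coord_surj 1 1.
exists (Frame (crd j) (crd i) S S' (shift n P mu i j) (shift n P mu j i)).
have single q x y : crd j q = x -> crd i q = y ->
    [set q | crd i q = y] `&` [set q | crd j q = x] = [set q].
  move=> qx qy; apply/seteqP; split=> r /=; last by move=> ->.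
  by move=> [ri rj]; apply: coord_inj; rewrite ?qx ?qy.
split=> /=.
- by split; [exact: coord_affine|exact: coord_side_line hP j|
    exact: coord_opp_side_line hP j].
- by split; [exact: coord_affine|exact: coord_side_line hP i|
    exact: coord_opp_side_line hP i].
- rewrite !(coord_opp_side_line hP) !(coord_side_line hP).
  by split; exact: single.
- have [s es] : side_line P i S by rewrite (coord_side_line hP).
  exists (P (i + n)%N + s *: edge P (i + n)%N); split; first by exists s.
    by rewrite (coord_sigma hP i j) -es Sj mulr0 subr0.
  exact: coord_opp_side hP i s.
- have [s es] : side_line P j S by rewrite (coord_side_line hP).
  exists (P (j + n)%N + s *: edge P (j + n)%N); split; first by exists s.
    exact: coord_opp_side hP j s.
  by rewrite (coord_sigma hP j i) -es Si mulr0 subr0.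
Qed.

Lemma is_frame_unique F F' : is_frame P n i j F -> is_frame P n i j F' -> F = F'.
Proof.
move=> /is_frameE[x y [S1 S2] [T1 T2] [A B]].
move=> /is_frameE[x' y' [S1' S2'] [T1' T2'] [A' B']].
case: F x y S1 S2 T1 T2 A B => /= _ _ S T _ _ -> -> S1 S2 T1 T2 -> ->.
case: F' x' y' S1' S2' T1' T2' A' B' => /= _ _ S' T' _ _ -> -> S1' S2' T1' T2' -> ->.
by congr Frame; apply: coord_inj; rewrite ?S1 ?S2 ?T1 ?T2.
Qed.

End Frame.

(** * The cell, the reflected lines and the envelope *)

Section Cell.
Context {R : realType} (n : nat) (P : nat -> 'rV[R]_2) (mu : nat -> R).
Context (p : 'rV[R]_2) (i j : nat).
Hypotheses (hP : cppos n P mu) (hp : (region P)° p).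
Hypothesis dij : det2 (edge P i) (edge P j) != 0.
Implicit Types (t : R) (q : 'rV[R]_2) (l : set 'rV[R]_2).

Local Notation crd := (coord n P).

(** The coefficients [m], [K], [a], [b] of the normal form of the reflected
    lines. *)
Definition mcoef : R := mu i.
Definition kcoef : R := mu j * crd j p * crd i p.
Definition acoef : R := shift n P mu i j - mu i * crd j p.
Definition bcoef : R := shift n P mu j i - mu j * crd i p.

Local Notation m := mcoef.
Local Notation K := kcoef.
Local Notation a := acoef.
Local Notation b := bcoef.
Local Notation u := (crd j p).
Local Notation v := (crd i p).

Lemma mcoef_gt0 : 0 < m. Proof. exact: mu_gt0 hP i. Qed.
Lemma u_gt0 : 0 < u. Proof. by case/andP: (coord_interior hP j hp). Qed.
Lemma v_gt0 : 0 < v. Proof. by case/andP: (coord_interior hP i hp). Qed.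
Lemma kcoef_gt0 : 0 < K.
Proof. exact: mulr_gt0 (mulr_gt0 (mu_gt0 hP j) u_gt0) v_gt0. Qed.

(** The affine coordinates of the frame with the origin moved to the point
    [C] of coordinates [1 + a] and [1 + b]. *)
Definition frame_mx : 'M[R]_3 := frame_at n P i j (1 + a) (1 + b).

Local Notation N := frame_mx.

Lemma hom_frame q : hom q *m N = row3 (crd j q - (1 + a)) (crd i q - (1 + b)) 1.
Proof. exact: hom_frame_at. Qed.

Lemma frame_affine : affine_mx N.
Proof. exact: frame_at_affine hP dij _ _. Qed.

(** The lines of the cell are parametrized by [t], where [crd j p + t] is the
    coordinate of the intersection point with the side [i]; the coordinate of
    the intersection point with the side [j] is then [crd i p + u v / t]. *)
Definition cell_param t : Prop :=
  0 < t /\ exists s r : R, [/\ 0 < s < 1, 0 < r < 1,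
    crd j (P i + s *: edge P i) = u + t &
    (crd i (P j + r *: edge P j) - v) * t = u * v].

(** The line through [p] with normal [(v, t)]; it contains the points of
    coordinates [(u + t, 0)] and [(0, v + u v / t)]. *)
Definition pencil_line t : 'rV[R]_3 :=
  row3 v t (- (v * (u - (1 + a)) + t * (v - (1 + b)))).

Lemma pencil_line_v t : (pencil_line t 0 0 != 0) || (pencil_line t 0 1 != 0).
Proof. by rewrite row3E gt_eqF ?v_gt0. Qed.

Lemma pencil_lineE t q : hline (pencil_line t *m N^T) q <->
  v * (crd j q - u) + t * (crd i q - v) = 0.
Proof.
rewrite hline_frame hom_frame /pairing !row3E.
by rewrite (_ : _ + _ + _ = v * (crd j q - u) + t * (crd i q - v)) //; ring.
Qed.

Lemma pencil_line_p t : hline (pencil_line t *m N^T) p.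
Proof. by apply/pencil_lineE; ring. Qed.

(** Collinearity of [p] with the points [(x, 0)] and [(0, y)] reads
    [(x - u) * (y - v) = u * v].  As [x] and [y] are positive, both factors must
    be positive: if both were negative their product would be less than
    [u * v]. *)
Lemma cell_lineP l : cell P p i j l ->
  exists2 t, cell_param t & l = hline (pencil_line t *m N^T).
Proof.
move=> [[ll lp] [X [Y [oX oY eXY]]]].
have [lX _] : (l `&` polygon_boundary P) X by rewrite eXY; left.
have [lY _] : (l `&` polygon_boundary P) Y by rewrite eXY; right.
have iX : crd i X = 0 by case: oX => s _ ->; exact: coord_own_side.
have jY : crd j Y = 0 by case: oY => s _ ->; exact: coord_own_side.
have jX : 0 < crd j X := coord_open_side_gt0 hP (nonparallel_mod hP dij) oX.
have iY : 0 < crd i Y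
  := coord_open_side_gt0 hP (nonparallel_mod hP (nonparallel_sym dij)) oY.
have col : (crd j X - u) * (crd i Y - v) = u * v.
  have := coord_det i j hP X Y p; rewrite (line_det2 ll lp lX lY) mulr0 iX jY => /eqP.
  by rewrite subr_eq0 !sub0r mulrNN mulrC [v * u]mulrC => /eqP <-; ring.
have u0 := u_gt0; have v0 := v_gt0.
have t0 : 0 < crd j X - u.
  rewrite ltNge; apply/negP => h.
  have : (u - crd j X) * (v - crd i Y) < u * v by nra.
  by rewrite -col; apply/negP; rewrite -leNgt; nra.
exists (crd j X - u).
  split=> //; case: oX iX jX col {eXY lX t0} => s hs ->.
  case: oY {lY} jY iY => r hr -> jY iY iX jX col.
  by exists s, r; split=> //; [rewrite subrKC|rewrite mulrC].
apply: (is_line_hline frame_affine ll lp lX).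
- by apply/eqP => e; move: iX; rewrite -e => e'; rewrite e' ltxx in v0.
- exact: pencil_line_v.
- exact/hline_frame/pencil_line_p.
- by apply/hline_frame/pencil_lineE; rewrite iX; ring.
Qed.

Lemma cell_param_points t : cell_param t -> exists X Y,
  [/\ open_side P i X, open_side P j Y, crd j X = u + t,
      (crd i Y - v) * t = u * v & X != Y /\
      line X Y = hline (pencil_line t *m N^T)].
Proof.
move=> [t0 [s [r [hs hr eX eY]]]].
exists (P i + s *: edge P i), (P j + r *: edge P j).
have iX := coord_own_side n P i s; have jY := coord_own_side n P j r.
set X := P i + _ in eX iX *; set Y := P j + _ in eY jY *.
have XY : X != Y.
  apply/eqP => e; have := addr_gt0 u_gt0 t0.
  by rewrite -eX e jY ltxx.
split=> //; [by exists s|by exists r|split=> //].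
apply: (is_line_hline frame_affine (line_is_line XY) (line_left _ _)
  (line_right _ _) XY (pencil_line_v t)).
  by apply/hline_frame/pencil_lineE; rewrite iX eX; ring.
apply/hline_frame/pencil_lineE; rewrite jY mulrC [t * _]mulrC eY.
by ring.
Qed.

Lemma cell_param_cell t : cell_param t ->
  cell P p i j (hline (pencil_line t *m N^T)).
Proof.
move=> /cell_param_points[X [Y [oX oY _ _ [XY eL]]]].
split; first by split; [rewrite -eL; exact: line_is_line|exact: pencil_line_p].
by exists X, Y; split=> //; rewrite -eL (line_boundary hP dij oX oY).
Qed.

Lemma cell_param_itv : (exists t, cell_param t) ->
  exists c d, [/\ 0 <= c, c < d & forall t, cell_param t <-> c < t < d].
Proof.
pose dx := det2 (edge P j) (edge P i) / width n P j.
pose dy := det2 (edge P i) (edge P j) / width n P i.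
have dx0 : dx != 0.
  by rewrite mulf_neq0 ?(nonparallel_sym dij) // invr_neq0 // gt_eqF // (width_gt0 hP).
have dy0 : dy != 0.
  by rewrite mulf_neq0 ?dij // invr_neq0 // gt_eqF // (width_gt0 hP).
pose x0 := crd j (P i); pose y0 := crd i (P j).
have E t : cell_param t <-> 0 < t /\
    (Num.min x0 (x0 + dx) - u < t < Num.max x0 (x0 + dx) - u /\
    (Num.min y0 (y0 + dy) - v) * t < u * v < (Num.max y0 (y0 + dy) - v) * t).
  have [t0|t0] := ltP 0 t; last first.
    by split=> -[t1 _] //; move: t0; rewrite leNgt t1.
  have hx := between_param x0 (u + t) dx0.
  have hy := between_param y0 (v + u * v / t) dy0.
  have -> : (Num.min x0 (x0 + dx) - u < t < Num.max x0 (x0 + dx) - u) =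
            (Num.min x0 (x0 + dx) < u + t < Num.max x0 (x0 + dx)).
    by rewrite ltrBlDl ltrBrDl.
  have -> : ((Num.min y0 (y0 + dy) - v) * t < u * v
               < (Num.max y0 (y0 + dy) - v) * t) =
      (Num.min y0 (y0 + dy) < v + u * v / t < Num.max y0 (y0 + dy)).
    have e1 x : (x * t < u * v) = (x < u * v / t) by rewrite ltr_pdivlMr.
    have e2 x : (u * v < x * t) = (u * v / t < x) by rewrite ltr_pdivrMr.
    by rewrite e1 e2 ltrBlDl ltrBrDl.
  rewrite -hx -hy; split=> [[_ [s [r [hs hr]]]]|[_ [[s hs es] [r hr er]]]].
    rewrite !coord_along => es er; do 2!split=> //; first by exists s.
    by exists r => //; rewrite -er mulfK ?gt_eqF // -/y0 -/dy subrKC.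
  split=> //; exists s, r; split; rewrite // !coord_along -/x0 -/y0 -/dx -/dy //.
  by rewrite er addrC addKr divfK // gt_eqF.
move=> [t /E[t0 ht]].
have [c [d [c0 cd H]]] := hyperbola_itv (mulr_gt0 u_gt0 v_gt0) (ex_intro2 _ _ t t0 ht).
  by exists c, d; split=> // s; rewrite E H.
Qed.

Local Notation refl t := (refl_line m K a b t).

(** The reflected points are on open sides of the polygon, hence strictly inside
    the supporting lines [j + n] and [i + n]. *)
Lemma cell_param_signs t : cell_param t -> b * t - K < 0 /\ a - m * t < 0.
Proof.
move=> [t0 [s [r [hs hr es er]]]].
have oX : open_side P (i + n)%N (P (i + n)%N + s *: edge P (i + n)%N).
  by exists s.
have oY : open_side P (j + n)%N (P (j + n)%N + r *: edge P (j + n)%N).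
  by exists r.
have := coord_opp_side_lt1 hP (nonparallel_mod hP dij) oX.
have := coord_opp_side_lt1 hP (nonparallel_mod hP (nonparallel_sym dij)) oY.
rewrite !(coord_sigma hP) es => h1 h2; split; last first.
  by rewrite /a /m; move: h2; lra.
have : b - (mu j * (crd i (P j + r *: edge P j) - v)) < 0.
  by rewrite /b; move: h1; lra.
rewrite -(pmulr_llt0 _ t0) mulrBl -mulrA er.
by rewrite /K mulrA.
Qed.

Lemma refl_line_v t : cell_param t ->
  (refl t 0 0 != 0) || (refl t 0 1 != 0).
Proof. by move=> /cell_param_signs[h _]; rewrite row3E lt_eqF. Qed.

Lemma refl_points t s r : cell_param t ->
  crd j (P i + s *: edge P i) = u + t ->
  (crd i (P j + r *: edge P j) - v) * t = u * v ->
  let X := P (i + n)%N + s *: edge P (i + n)%N in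
  let Y := P (j + n)%N + r *: edge P (j + n)%N in
  [/\ hom X *m N = row3 (- m * t) (- b) 1,
      hom Y *m N = row3 (- a) (- K / t) 1, X != Y &
      line X Y = hline (refl t *m N^T)].
Proof.
move=> ct es er X Y; have [t0 _] := ct.
have [_ sg] := cell_param_signs ct.
have hX : hom X *m N = row3 (- m * t) (- b) 1.
  rewrite hom_frame (coord_sigma hP) (coord_opp_side hP) es.
  by congr row3; rewrite /a /m; ring.
have hY : hom Y *m N = row3 (- a) (- K / t) 1.
  rewrite hom_frame (coord_sigma hP j i) (coord_opp_side hP).
  congr row3; first by ring.
  apply: (mulIf (lt0r_neq0 t0)); rewrite divfK ?gt_eqF //.
  transitivity (- (mu j * ((crd i (P j + r *: edge P j) - v) * t))).
    by rewrite /b; ring.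
  by rewrite er /K; ring.
have XY : X != Y.
  apply/eqP => e; have := hX; rewrite e hY => /rowP/(_ 0); rewrite !row3E => e0.
  by move: sg; rewrite -[a]opprK e0 mulNr opprK subrr ltxx.
split=> //; apply: (is_line_hline frame_affine (line_is_line XY) (line_left _ _)
  (line_right _ _) XY (refl_line_v ct)).
  by rewrite hX /pairing !row3E; ring.
by rewrite hY /pairing !row3E; field; rewrite gt_eqF.
Qed.

Lemma reflected_cellP t l : cell_param t ->
  reflected P n (hline (pencil_line t *m N^T)) l <->
  l = hline (refl t *m N^T).
Proof.
move=> ct; have [X [Y [oX oY eX eY [XY eL]]]] := cell_param_points ct.
have bXY := line_boundary hP dij oX oY.
rewrite -eL; split.
  move=> [_ _ [x [y [x' [y' [xy bxy sx sy ->]]]]]].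
  have [||[ex ey]|[ex ey]] := @set2_eq _ x y X Y.
  - by rewrite -bxy bXY.
  - exact/eqP.
  - subst x y; have [s [hs es ->]] := sigma_open_side hP oX sx.
    have [r [hr er ->]] := sigma_open_side hP oY sy.
    by rewrite es in eX; rewrite er in eY; have [] := refl_points ct eX eY.
  - subst x y; have [s [hs es ->]] := sigma_open_side hP oY sx.
    have [r [hr er ->]] := sigma_open_side hP oX sy.
    rewrite lineC.
    by rewrite er in eX; rewrite es in eY; have [] := refl_points ct eX eY.
move=> ->; split; first exact: line_is_line.
  exists p; split; last exact: hp.
  by rewrite eL; exact: pencil_line_p.
case: oX oY eX eY => s hs es [r hr er] eX eY.
rewrite es in eX; rewrite er in eY.
have [_ _ _ <-] := refl_points ct eX eY.
exists X, Y; do 2!eexists; split; [by []|exact: bXY| | |reflexivity].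
  by rewrite es; exact: open_side_sigma.
by rewrite er; exact: open_side_sigma.
Qed.

Let aN : affine_mx N := frame_affine.
Let uN : N \in unitmx := aN.1.

Lemma cross_frame (w w' : 'rV[R]_3) : cross w w' *m N =
  \det N *: cross (w *m (invmx N)^T) (w' *m (invmx N)^T).
Proof.
have e (z : 'rV[R]_3) : z = z *m (invmx N)^T *m N^T.
  by rewrite -mulmxA -trmx_mul mulmxV // trmx1 mulmx1.
by rewrite {1}(e w) {1}(e w') cross_mulmx.
Qed.

Lemma hline_dual (w : 'rV[R]_3) q :
  hline w q <-> pairing (hom q *m N) (w *m (invmx N)^T) = 0.
Proof. by rewrite pairing_cancel // hlineE. Qed.

(** Zero line coordinates would describe the whole plane, not a line. *)
Lemma hline_eq_dual0 (w w' : 'rV[R]_3) :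
  (w' 0 0 != 0) || (w' 0 1 != 0) -> hline w = hline (w' *m N^T) ->
  w *m (invmx N)^T != 0.
Proof.
move=> w'0 e; apply/eqP => w0.
have full x y : pairing (row3 x y 1) w' = 0.
  have [q hq] := frame_point x y aN.
  by rewrite -hq -hline_frame -e; apply/hline_dual; rewrite w0 /pairing !mxE; ring.
have := full 0 0; have := full 1 0; have := full 0 1.
rewrite /pairing !row3E !mul0r !mul1r !add0r ?addr0 => h1 h2 h3.
by move: w'0; rewrite h3 ?addr0 in h1 h2; rewrite h1 h2 eqxx.
Qed.

(** The parametrization by [t] itself has polynomial lifts. *)
Lemma envelope_exists c d : c < d ->
  (forall t, cell_param t <-> c < t < d) ->
  exists E, cellwise_envelope P n p i j E.
Proof.
move=> cd H.
suff [lam [ell hpar]] : exists lam ell, cell_parametrization P n p i j c d lam ell.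
  by eexists; exists c, d, lam, ell; split; first exact: hpar.
exists (fun t => pencil_line t *m N^T), (fun t => refl t *m N^T).
pose y0 : 'rV[R]_3 := row3 v 0 (- (v * (u - (1 + a)))).
pose y1 : 'rV[R]_3 := row3 0 1 (- (v - (1 + b))).
have elam : (fun t => pencil_line t *m N^T) = fun t : R =>
    t *: (t *: (0 : 'rV[R]_3)) + t *: (y1 *m N^T) + y0 *m N^T.
  apply/funext => t; rewrite !scaler0 add0r scalemxAl -mulmxDl; congr (_ *m _).
  by apply: row3P; rewrite !mxE /=; ring.
pose z0 : 'rV[R]_3 := row3 (- K) 0 0.
pose z1 : 'rV[R]_3 := row3 b a (a * b - m * K).
pose z2 : 'rV[R]_3 := row3 0 (- m) 0.
have eell : (fun t => refl t *m N^T) = fun t : R =>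
    t *: (t *: (z2 *m N^T)) + t *: (z1 *m N^T) + z0 *m N^T.
  apply/funext => t; rewrite !scalemxAl -!mulmxDl; congr (_ *m _).
  by apply: row3P; rewrite !mxE /=; ring.
split=> // [t ht|l cl|t ht].
- have hd := is_derive_quadratic (y0 *m N^T) (y1 *m N^T) 0 t.
  rewrite -elam scaler0 scaler0 add0r in hd.
  split; first by case: hd.
    rewrite derive1E; have [_ ->] := hd.
    apply/eqP => e; have := cross_mulmx N (pencil_line t) y1.
    rewrite e mul0mx => /rowP/(_ 2).
    rewrite [LHS]mxE [RHS]mxE /cross !row3E => /esym/eqP.
    rewrite mulr0 mulr1 subr0 mulf_eq0 (gt_eqF v_gt0) orbF.
    by move: uN; rewrite unitmxE unitfE => /negPf ->.
  by apply: cell_param_cell => //; apply/H.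
- by have [t /H ct ->] := cell_lineP cl; exists t.
- have ct : cell_param t by apply/H.
  split; last exact/(reflected_cellP _ ct).
  have := is_derive_quadratic (z0 *m N^T) (z1 *m N^T) (z2 *m N^T) t.
  by rewrite -eell => -[].
Qed.

Lemma pencil_line_frame (w : 'rV[R]_3) t : cell_param t ->
  hline w = hline (pencil_line t *m N^T) ->
  let L := w *m (invmx N)^T in
  [/\ L 0 0 * (u - (1 + a)) + L 0 1 * (v - (1 + b)) + L 0 2 = 0,
      t * L 0 0 = v * L 0 1 & L 0 0 != 0].
Proof.
move=> ct e L.
have L0 : L != 0 := hline_eq_dual0 (pencil_line_v t) e.
have [X [Y [oX oY eX eY [XY eL]]]] := cell_param_points ct.
have iX : crd i X = 0 by case: oX => s _ ->; exact: coord_own_side.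
have : hline w p by rewrite e; exact: pencil_line_p.
have : hline w X by rewrite e -eL; exact: line_left.
move/hline_dual; rewrite -/L hom_frame iX eX /pairing !row3E => h1.
move/hline_dual; rewrite -/L hom_frame /pairing !row3E => h2.
have h3 : t * L 0 0 = v * L 0 1 by lra.
have [t0 _] := ct; have v0 := v_gt0.
split; [by lra|exact: h3|apply: contra_neq L0 => L00].
move: h3; rewrite L00 mulr0 => /esym/eqP.
rewrite mulf_eq0 (gt_eqF v0) => /= /eqP L01.
apply: row3P; rewrite [RHS]mxE //.
by move: h2; rewrite L00 L01; lra.
Qed.

Lemma refl_line_frame (w : 'rV[R]_3) t : cell_param t ->
  hline w = hline (refl t *m N^T) ->
  let G := w *m (invmx N)^T in
  [/\ G 0 2 = m * t * G 0 0 + b * G 0 1,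
      t * G 0 2 = a * t * G 0 0 + K * G 0 1 & G 0 0 != 0].
Proof.
move=> ct e G; have [sg _] := cell_param_signs ct.
have G0 : G != 0 := hline_eq_dual0 (refl_line_v ct) e.
have [t0 [s [r [hs hr es er]]]] := ct.
have [hX hY XY eL] := refl_points ct es er.
have : hline w (P (i + n)%N + s *: edge P (i + n)%N).
  by rewrite e -eL; exact: line_left.
move/hline_dual; rewrite -/G hX /pairing !row3E => h1.
have : hline w (P (j + n)%N + r *: edge P (j + n)%N).
  by rewrite e -eL; exact: line_right.
move/hline_dual; rewrite -/G hY /pairing !row3E => h2.
have h3 : G 0 2 = m * t * G 0 0 + b * G 0 1 by lra.
have h4 : t * G 0 2 = a * t * G 0 0 + K * G 0 1.
  have {}h2 : G 0 2 = a * G 0 0 + K / t * G 0 1 by lra.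
  by rewrite h2; field; rewrite gt_eqF.
split=> //; apply: contra_neq G0 => G00.
by rewrite (refl_line_through (ltr0_neq0 sg) h3 h4) G00 mul0r scale0r.
Qed.

(** The parameter [T] of the moving line is a differentiable function of the
    given parametrization, and regularity of the latter says [T' <> 0]. The
    lift of the reflected line is a multiple of [refl (T s)] by a function [k],
    so the envelope point only changes by the factor [k^2 T']. *)
Lemma envelope_unique c d E : (forall t, cell_param t <-> c < t < d) ->
  cellwise_envelope P n p i j E -> E = envelope_arc N m K a b c d.
Proof.
move=> H [c' [d' [lam [ell [[cd' hlam hsurj hell] ->]]]]].
pose L s := lam s *m (invmx N)^T; pose L' s := derive1 lam s *m (invmx N)^T.
pose G s := ell s *m (invmx N)^T; pose G' s := derive1 ell s *m (invmx N)^T.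
pose T s := v * (L s 0 1 / L s 0 0).
have v0 := lt0r_neq0 v_gt0.
have hT s : c' < s < d' -> [/\ cell_param (T s),
    hline (lam s) = hline (pencil_line (T s) *m N^T),
    L s 0 0 * (u - (1 + a)) + L s 0 1 * (v - (1 + b)) + L s 0 2 = 0 &
    L s 0 0 != 0].
  move=> hs; have [_ _ /cell_lineP[t ct e]] := hlam s hs.
  have [h1 h2 h3] := pencil_line_frame ct e.
  have -> : T s = t.
    by rewrite /T mulrA -h2 mulfK.
  by split.
have hG s : c' < s < d' -> [/\ G s 0 2 = m * T s * G s 0 0 + b * G s 0 1,
    T s * G s 0 2 = a * T s * G s 0 0 + K * G s 0 1 & G s 0 0 != 0].
  move=> hs; have [ct e _ _] := hT s hs; apply: (refl_line_frame ct).
  by apply/(reflected_cellP _ ct); rewrite -e; have [] := hell s hs.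
have cross_pt s : c' < s < d' ->
    proj_eq (cross (ell s) (derive1 ell s))
            (envelope_pt m K a b (T s) *m invmx N).
  move=> hs; have [ct _ hLp L0] := hT s hs; have [hG1 hG2 G0] := hG s hs.
  have [dlam reg _] := hlam s hs; have [dell _] := hell s hs.
  have dL k : is_derive s 1 (fun t => L t 0 k) (L' s 0 k).
    exact: is_derive_mulmx.
  have dG k : is_derive s 1 (fun t => G t 0 k) (G' s 0 k).
    exact: is_derive_mulmx.
  pose T' := v * ((L' s 0 1 * L s 0 0 - L s 0 1 * L' s 0 0) / L s 0 0 ^+ 2).
  have dT : is_derive s 1 T T'.
    exact: is_derive_scale (is_derive_div (dL 1) (dL 0) L0).
  have T'0 : T' != 0.
    apply: contra_neq reg => T'0.
    (* If [T' = 0] then [L'] is a multiple of [L]: both are orthogonal to the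
       coordinates of [p]. *)
    have e1 : L' s 0 1 = L' s 0 0 / L s 0 0 * L s 0 1.
      move/eqP: T'0; rewrite mulf_eq0 (negPf v0) /= mulf_eq0 invr_eq0 expf_eq0 /=.
      rewrite (negPf L0) orbF subr_eq0 => /eqP e1.
      by apply: (mulIf L0); rewrite e1; field.
    have e2 : L' s 0 2 = L' s 0 0 / L s 0 0 * L s 0 2.
      have : L' s 0 0 * (u - (1 + a)) + L' s 0 1 * (v - (1 + b)) + L' s 0 2 = 0.
        apply: (@is_derive_itv0 _ (fun t => (u - (1 + a)) * L t 0 0 +
          (v - (1 + b)) * L t 0 1 + L t 0 2) c' d' s) => //.
          by move=> t /hT[_ _ <- _]; ring.
        have := is_derive_funD (is_derive_funD (is_derive_scale (u - (1 + a))
          (dL 0)) (is_derive_scale (v - (1 + b)) (dL 1))) (dL 2).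
        by rewrite ![(_ - _) * L' _ _ _]mulrC.
      have -> : L s 0 2 = - (L s 0 0 * (u - (1 + a)) + L s 0 1 * (v - (1 + b))).
        by apply/eqP; rewrite -addr_eq0 addrC hLp.
      move=> h; apply/eqP; rewrite -subr_eq0 -[X in _ == X]h e1.
      by apply/eqP; field.
    have crossL : cross (L s) (L' s) = 0.
      by apply: row3P; rewrite [RHS]mxE /cross !row3E ?e1 ?e2; field.
    apply/eqP; rewrite -(mulmx_unit_eq0 _ uN) cross_frame -/(L s) -/(L' s).
    by rewrite crossL scaler0.
  have dG1 : G' s 0 2 = m * T s * G' s 0 0 + m * T' * G s 0 0 + b * G' s 0 1.
    have : G' s 0 2 - (m * T s * G' s 0 0 + m * T' * G s 0 0 + b * G' s 0 1) = 0.
      apply: (@is_derive_itv0 _ (fun t => G t 0 2 +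
          - m * (T t * G t 0 0) + - b * G t 0 1) c' d' s) => //.
        by move=> t /hG[-> _ _]; ring.
      have e := is_derive_funD (is_derive_funD (dG 2) (is_derive_scale (- m)
        (is_derive_funM dT (dG 0)))) (is_derive_scale (- b) (dG 1)).
      by apply: is_derive_eq e _; ring.
    by move/eqP; rewrite subr_eq0 => /eqP.
  have dG2 : T s * G' s 0 2 + T' * G s 0 2 =
      a * T s * G' s 0 0 + a * T' * G s 0 0 + K * G' s 0 1.
    have : T s * G' s 0 2 + T' * G s 0 2 -
        (a * T s * G' s 0 0 + a * T' * G s 0 0 + K * G' s 0 1) = 0.
      apply: (@is_derive_itv0 _ (fun t => T t * G t 0 2 +
          - a * (T t * G t 0 0) + - K * G t 0 1) c' d' s) => //.
        by move=> t /hG[_ -> _]; ring.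
      have e := is_derive_funD (is_derive_funD (is_derive_funM dT (dG 2))
        (is_derive_scale (- a) (is_derive_funM dT (dG 0))))
        (is_derive_scale (- K) (dG 1)).
      by apply: is_derive_eq e _; ring.
    by move/eqP; rewrite subr_eq0 => /eqP.
  have [/ltr0_neq0 sg _] := cell_param_signs ct.
  have := cross_refl_line sg hG1 hG2 dG1 dG2.
  set k := (X in X *: _) => eG.
  have k0 : k != 0 by rewrite mulf_neq0 ?expf_neq0 // mulf_neq0 ?invr_neq0.
  have N0 : \det N != 0 by rewrite -unitfE -unitmxE.
  exists (\det N * k); split; first exact: mulf_neq0.
  rewrite -[LHS](mulmxK uN) cross_frame -/(G s) -/(G' s) eG scalerA.
  by rewrite -scalemxAl.
apply/seteqP; split=> w [s hs hw].
  have [ct _ _ _] := hT s hs; exists (T s); first exact/H.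
  exact: proj_eq_trans hw (cross_pt s hs).
have ct : cell_param s by apply/H.
have [s' hs' e] := hsurj _ (cell_param_cell ct).
exists s' => //; apply: proj_eq_trans hw (proj_eq_sym _).
suff <- : T s' = s by exact: cross_pt.
have [_ h2 h3] := pencil_line_frame ct (esym e).
by rewrite /T mulrA -h2 mulfK.
Qed.

End Cell.

(** * The classification *)

(** For [be = 0] the curve is [(0, 0, w)] with
    [w = m t (K - b t) + K (m t - a)], which is positive. *)
Lemma envelope_arc_point (R : realType) (N : 'M[R]_3) (m K a b c d : R)
    (C : 'rV[R]_2) :
  affine_mx N -> 0 < m -> 0 < K -> 0 <= c -> c < d ->
  (forall t, c < t < d -> b * t - K < 0 /\ a - m * t < 0) ->
  a * b - m * K = 0 -> hom C *m N = row3 0 0 1 ->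
  envelope_arc N m K a b c d = hpoint C.
Proof.
move=> [uN _] m0 K0 c0 cd sgn be0 eC.
have pt t : c < t < d ->
    proj_eq (envelope_pt m K a b t *m invmx N) (hom C).
  move=> ht; have [s1 s2] := sgn t ht.
  have t0 : 0 < t by case/andP: ht => /(le_lt_trans c0).
  have w0 : 0 < 2 * m * K * t - m * b * t ^+ 2 - a * K.
    rewrite (_ : _ - _ = m * t * (K - b * t) + K * (m * t - a)); last by ring.
    by rewrite addr_gt0 // !mulr_gt0 // subr_gt0 -subr_lt0.
  exists (2 * m * K * t - m * b * t ^+ 2 - a * K); split; first exact: lt0r_neq0.
  rewrite -[hom C](mulmxK uN) eC scalemxAl; congr (_ *m _).
  by apply: row3P; rewrite [RHS]mxE /envelope_pt be0 !row3E; ring.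
apply/seteqP; split=> w /=.
  by move=> [t ht hw]; exact: proj_eq_trans hw (pt t ht).
move=> hw; pose t := c + (d - c) / 2.
have ht : c < t < d by apply/andP; split; rewrite /t; lra.
by exists t => //; exact: proj_eq_trans hw (proj_eq_sym (pt t ht)).
Qed.

Theorem proposition6p6 (R : realType) (n : nat) (P : nat -> 'rV[R]_2)
    (mu : nat -> R) (p : 'rV[R]_2) (i j : nat)
    (hP : cppos n P mu) (hp : (region P)° p)
    (hcell : cell P p i j !=set0)
    (hij : det2 (edge P i) (edge P j) != 0) :
  (exists! x : 'rV[R]_2 -> R, [/\ affine_fun x,
     side_line P j = [set q | x q = 0] &
     side_line P (j + n)%N = [set q | x q = 1]]) /\
  (exists! y : 'rV[R]_2 -> R, [/\ affine_fun y,
     side_line P i = [set q | y q = 0] &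
     side_line P (i + n)%N = [set q | y q = 1]]) /\
  (exists! F : frame, is_frame P n i j F) /\
  (exists! E : set 'rV[R]_3, cellwise_envelope P n p i j E) /\
  forall (F : frame) (E : set 'rV[R]_3),
    is_frame P n i j F -> cellwise_envelope P n p i j E ->
    let b := beta_ij mu i j p F in
    [/\ 0 < fx F p < 1, 0 < fy F p < 1, fx F (fSstar F) = 1 &
        fy F (fSstar F) = 1] /\
    (forall F' : frame, is_frame P n j i F' -> beta_ij mu j i p F' = b) /\
    exactly_one (arc_of ellipse E) (arc_of hyperbola E) (is_finite_point E) /\
    (0 < b -> arc_of ellipse E) /\
    (b < 0 -> arc_of hyperbola E) /\
    (b = 0 -> exists C : 'rV[R]_2,
       [/\ unique (fun q => fx F q = 1 + fA F - mu i * fx F p /\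
                            fy F q = 1 + fB F - mu j * fy F p) C,
           forall l m, cell P p i j l -> reflected P n l m -> m C &
           E = hpoint C]) /\
    ~ arc_of parabola E /\
    ~ arc_of degenerate_conic E /\
    exists Qi Qj : 'rV[R]_2,
      [/\ unique (fun q => sigma_ext P n i q (fSstar F)) Qi,
          unique (fun q => sigma_ext P n j q (fSstar F)) Qj &
          b = 0 <-> det2 (Qi - p) (Qj - p) = 0].
Proof.
have coord_spec k : exists! x : 'rV[R]_2 -> R, [/\ affine_fun x,
    side_line P k = [set q | x q = 0] &
    side_line P (k + n)%N = [set q | x q = 1]].
  exists (coord n P k); split; last first.
    by move=> x [ax x0 x1]; rewrite (coord_unique hP ax x0 x1).
  by split; [exact: coord_affine|exact: coord_side_line hP k|
    exact: coord_opp_side_line hP k].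
split; first exact: coord_spec.
split; first exact: coord_spec.
split.
  have [F0 hF0] := is_frame_exists hP hij; exists F0; split=> // F'.
  exact: is_frame_unique hP hij _ _ hF0.
have [l /(cell_lineP hP hp hij)[t0 ct0 _]] := hcell.
have [c [d [c0 cd hcd]]] := cell_param_itv hP hp hij (ex_intro _ t0 ct0).
have uniqueE E := envelope_unique hP hp hij hcd (E := E).
split.
  have [E hE] := envelope_exists hP hp hij cd hcd; exists E; split=> // E' hE'.
  by rewrite (uniqueE _ hE) (uniqueE _ hE').
move=> F E hF /uniqueE eE be.
have [xE yE [S1 S2] [T1 T2] [AE BE]] := is_frameE hP hF.
set m := mcoef mu i in eE; set K := kcoef n P mu p i j in eE.
set a := acoef n P mu p i j in eE; set b := bcoef n P mu p i j in eE.
set N := frame_mx n P mu p i j in eE.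
have m0 : 0 < m := mcoef_gt0 i hP.
have K0 : 0 < K := kcoef_gt0 i j hP hp.
have aN : affine_mx N := frame_affine p hP hij.
have beE : be = a * b - m * K.
  by rewrite /be /beta_ij xE yE AE BE /a /b /m /K /acoef /bcoef /mcoef /kcoef; ring.
have [C [CX CY]] := coord_surj hP hij (1 + a) (1 + b).
have hC : hom C *m N = row3 0 0 1 by rewrite hom_frame CX CY !subrr.
have sgn t : c < t < d -> b * t - K < 0 /\ a - m * t < 0.
  by move/hcd; exact: cell_param_signs.
have pointE : be = 0 -> E = hpoint C.
  by rewrite beE eE => be0; exact: envelope_arc_point.
have not_arc : be = 0 -> forall type, ~ arc_of type E.
  move=> /pointE eC type [C' _ /arc_two_points h].
  by apply: (h (hom C)); rewrite eC.
split.
  by rewrite xE yE; split; rewrite ?(coord_interior hP).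
split.
  move=> F' /(is_frameE hP)[xE' yE' _ _ [AE' BE']].
  by rewrite /be /beta_ij xE yE AE BE xE' yE' AE' BE'; ring.
have types : [/\ 0 < be -> arc_of ellipse E, be < 0 -> arc_of hyperbola E,
    ~ arc_of parabola E, ~ arc_of degenerate_conic E &
    exactly_one (arc_of ellipse E) (arc_of hyperbola E) (is_finite_point E)].
  have [be0|be0] := eqVneq be 0.
    have nA := not_arc be0; rewrite be0 ltxx; split=> //; constructor 3.
    by split; [exact: nA|exact: nA|exists C; exact: pointE].
  rewrite beE in be0; rewrite eE beE.
  have hE := gt0_arc_of_ellipse aN m0 K0 be0 cd c0.
  have hH := lt0_arc_of_hyperbola aN m0 K0 be0 cd c0.
  have Eh := arc_of_ellipse_gt0 aN m0 K0 be0 cd.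
  have Hh := arc_of_hyperbola_lt0 aN m0 K0 be0 cd.
  have np := not_finite_point aN m0 K0 be0 cd c0.
  split=> //.
  - exact: not_arc_of_parabola.
  - exact: not_arc_of_degenerate.
  have [lt|gt|/eqP] := ltgtP (a * b - m * K) 0; last by rewrite (negPf be0).
    constructor 2; split=> //; last exact: hH.
    by move/Eh; rewrite ltNge (ltW lt).
  constructor 1; split=> //; first exact: hE.
  by move/Hh; rewrite ltNge (ltW gt).
have [tE tH nP nD tX] := types.
split=> //; split=> //; split=> //; split.
  move=> be0; exists C; split; last exact: pointE.
  - rewrite xE yE AE BE; split.
      by rewrite CX CY /a /b /acoef /bcoef; split; ring.
    move=> q [qx qy]; apply: (coord_inj hP hij).
      by rewrite qx CX /a /acoef; ring.
    by rewrite qy CY /b /bcoef; ring.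
  - move=> l0 l' /(cell_lineP hP hp hij)[t ct ->].
    move/(reflected_cellP hP hp hij _ ct) => ->.
    apply/hline_frame; rewrite hC /pairing !row3E -/a -/b -/m -/K -beE be0.
    by ring.
split=> //; split=> //.
have [Si Sj] : side_line P (i + n)%N (fSstar F) /\ side_line P (j + n)%N (fSstar F).
  by rewrite !(coord_opp_side_line hP).
have preimage k : side_line P (k + n)%N (fSstar F) ->
    exists Q, unique (fun q => sigma_ext P n k q (fSstar F)) Q.
  move=> [s es]; exists (P k + s *: edge P k); split; first by exists s.
  move=> _ [s' [-> es']]; congr (_ + _ *: _).
  move/eqP: es'; rewrite es (inj_eq (addrI _)) -subr_eq0 -scalerBl.
  by rewrite scaler_eq0 (negPf (edge_neq0 hP _)) orbF subr_eq0 => /eqP.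
have [Qi hQi] := preimage i Si; have [Qj hQj] := preimage j Sj.
exists Qi, Qj; split=> //.
have [[s [esi es]] _] := hQi; have [[r [erj er]] _] := hQj.
have Qi0 : coord n P i Qi = 0 by rewrite esi; exact: coord_own_side.
have Qj0 : coord n P j Qj = 0 by rewrite erj; exact: coord_own_side.
have AQ : shift n P mu i j = mu i * coord n P j Qi.
  by have := T1; rewrite es (coord_sigma hP i j) -esi; lra.
have BQ : shift n P mu j i = mu j * coord n P i Qj.
  by have := T2; rewrite er (coord_sigma hP j i) -erj; lra.
have := coord_det i j hP Qi Qj p; rewrite Qi0 Qj0 !sub0r.
set k := (X in _ = X * _) => e.
have k0 : k != 0.
  rewrite mulf_neq0 ?oppr_eq0 // invr_neq0 // mulf_neq0 // gt_eqF //;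
    exact: width_gt0 hP _.
have -> : be = mu i * mu j * k * det2 (Qi - p) (Qj - p).
  rewrite -mulrA -e beE /a /b /m /K /acoef /bcoef /mcoef /kcoef AQ BQ; ring.
have c'0 : mu i * mu j * k != 0 
  by rewrite mulf_neq0 // mulf_neq0 // gt_eqF // (mu_gt0 hP).
split=> [/eqP|->]; last by rewrite mulr0.
by rewrite mulf_eq0 (negPf c'0) => /eqP.
Qed.
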